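(* Let $A:[0,1]\to\mathbb{R}$ be continuous with $A(0)=A(1)=0$, $A\not\equiv0$, and suppose that for some $\varpi\in[0,1/2)$ $$\sup_{t\in(0,1)}\frac{|A(t)|}{[t(1-t)]^{1-\varpi}}<\infty .$$ Let $\theta_n\in(0,1)$, $\theta_n\to 0$, be such that $F_n(t)=t+\theta_nA(t)$, $t\in(0,1)$, are distribution functions, with $P_{\theta_n}$ the distribution having distribution function $F_n$. Assume $\theta_n=o(n^{-\varpi})$ and $\log(n\theta_n^2)/\log\log n\to\infty$ as $n\to\infty$. Then the intermediate efficiency $e_{\mathcal{M}\mathcal{K}}$ of $\mathcal{M}_n$ with respect to $\mathcal{K}_n$ under $\{P_{\theta_n}^n\}$ exists and equals $$e_{\mathcal{M}\mathcal{K}}=\lim_{n\to\infty}\frac{c_{\mathcal{M}}[b_{\mathcal{M}}(P_{\theta_n}^n)]^2}{c_{\mathcal{K}}[b_{\mathcal{K}}(P_{\theta_n}^n)]^2}=0,$$ where $c_{\mathcal{M}}=c_{\mathcal{K}}=2$, $b_{\mathcal{M}}(P_{\theta_n}^n)=\sqrt{\log\bigl(\sqrt n\,\theta_n\sup_{0<t<1}|A(t)|/\sqrt{t(1-t)}\bigr)}$ and $b_{\mathcal{K}}(P_{\theta_n}^n)=\sqrt n\,\theta_n\sup_{0<t<1}|A(t)|$.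
   Context: Let $X_1,\dots,X_n$ be i.i.d. with values in $(0,1)$ and empirical distribution function $\hat F_n$. The null hypothesis is that the $X_i$ are uniform on $(0,1)$; $P_0$ is the uniform distribution, and $P_0^n$, $P_{\theta_n}^n$ are $n$-fold products. The statistics (large values are significant) are $$\mathcal{K}_n=\sqrt n\sup_{0<t<1}|\hat F_n(t)-t|,\qquad \mathcal{S}_n=\sqrt n\sup_{0<t<1}\frac{|\hat F_n(t)-t|}{\sqrt{t(1-t)}},\qquad \mathcal{M}_n=\sqrt{\log(\mathcal{S}_n+1)} .$$ Intermediate efficiency (pathwise variant of Kallenberg's notion). For a statistic $\mathcal{U}_n$ and a level $\alpha\in(0,1)$ let $u_{\alpha,n}=\inf\{u:P_0^n(\mathcal{U}_n>u)\le\alpha\}$ be its critical value; the test rejects when $\mathcal{U}_n>u_{\alpha,n}$. Write $k_{\alpha,n}$ for the critical value of $\mathcal{K}_n$. Call a sequence of levels $\{\alpha_n\}$ admissible for $\mathcal{U}$ if $\alpha_n\to0$, $n^{-1}\log\alpha_n\to0$, and $$0<\liminf_{n}P_{\theta_n}^n(\mathcal{U}_n>u_{\alpha_n,n})\le\limsup_nP_{\theta_n}^n(\mathcal{U}_n>u_{\alpha_n,n})<1.$$ For such a sequence let $N(n)$ be the smallest $m$ such that $P_{\theta_n}^{m+k}(\mathcal{K}_{m+k}>k_{\alpha_n,m+k})\ge P_{\theta_n}^n(\mathcal{U}_n>u_{\alpha_n,n})$ for all integers $k\ge0$ (here $\theta_n$ and $\alpha_n$ are held fixed while the sample size of $\mathcal{K}$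 varies). The intermediate efficiency of $\mathcal{U}_n$ with respect to $\mathcal{K}_n$ under $\{P_{\theta_n}^n\}$ exists and equals $e$ if admissible sequences exist and $\lim_{n\to\infty}N(n)/n=e$ for each of them. *)

(* Defs.v *)
From HB Require Import structures.
From mathcomp Require Import all_boot all_order all_algebra.
From mathcomp Require Import all_classical all_reals all_analysis.

Set Implicit Arguments.
Unset Strict Implicit.
Unset Printing Implicit Defensive.

Import Order.TTheory GRing.Theory Num.Theory.
Import numFieldNormedType.Exports.

Local Open Scope classical_set_scope.
Local Open Scope ring_scope.

Section product_power.
Context d (T : measurableType d) (R : realType).

Definition tuple_cons n (p : T * n.-tuple T) : n.+1.-tuple T :=
  [the n.+1.-tuple T of p.1 :: p.2].

Lemma measurable_tuple_cons n : measurable_fun [set: T * n.-tuple T] (@tuple_cons n).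
Proof. by apply: measurable_cons. Qed.

HB.instance Definition _ n :=
  isMeasurableFun.Build _ _ _ _ (@tuple_cons n) (@measurable_tuple_cons n).

Fixpoint product_power (P : probability T R) (n : nat) :
    probability (n.-tuple T) R :=
  match n with
  | 0 => \d_([tuple] : 0.-tuple T)
  | m.+1 => distribution (P \x product_power P m)%E (@tuple_cons m)
  end.

End product_power.

Section statistics.
Context {R : realType}.

Definition edf n (x : n.-tuple R) (t : R) : R :=
  (\sum_(i < n) (tnth x i <= t)%R%:R) / n%:R.

Definition Kstat n (x : n.-tuple R) : R :=
  Num.sqrt n%:R * sup [set `|edf x t - t| | t in `]0, 1[].

(* When some observation lies outside `]0, 1[, the set below is unbounded and
   the real-valued sup defaults to 0; samples with values in `]0, 1[, which
   have full probability in every model considered, give a bounded set. *)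
Definition Sstat n (x : n.-tuple R) : R :=
  Num.sqrt n%:R *
  sup [set `|edf x t - t| / Num.sqrt (t * (1 - t)) | t in `]0, 1[].

Definition Mstat n (x : n.-tuple R) : R := Num.sqrt (ln (Sstat x + 1)).

End statistics.

Section intermediate_efficiency.
Context {R : realType}.

Definition statistic := forall n, n.-tuple R -> R.

Definition unif01 : probability (measurableTypeR R) R :=
  uniform_prob (@ltr01 R).

Definition exceed_prob (P : probability (measurableTypeR R) R)
    (U : statistic) (n : nat) (u : R) : \bar R :=
  product_power P n [set x | u < U n x].

Definition critical_value (U : statistic) (alpha : R) (n : nat) : R :=
  inf [set u | (exceed_prob unif01 U n u <= alpha%:E)%E].

Definition power (P : probability (measurableTypeR R) R) (U : statistic)
    (alpha : R) (n : nat) : \bar R :=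
  exceed_prob P U n (critical_value U alpha n).

(* [P n] is the distribution of a single observation at stage [n]. *)
Definition admissible (U : statistic)
    (P : nat -> probability (measurableTypeR R) R) (alpha : nat -> R) : Prop :=
  [/\ forall n, 0 < alpha n < 1,
      alpha @ \oo --> (0 : R),
      n%:R^-1 * ln (alpha n) @[n --> \oo] --> (0 : R) &
      [/\ (0 < limn_einf (fun n => power (P n) U (alpha n) n))%E,
          (limn_einf (fun n => power (P n) U (alpha n) n) <=
           limn_esup (fun n => power (P n) U (alpha n) n))%E &
          (limn_esup (fun n => power (P n) U (alpha n) n) < 1)%E]].

(* The smallest m; +oo when there is none. *)
Definition required_size (U V : statistic)
    (P : nat -> probability (measurableTypeR R) R) (alpha : nat -> R)
    (n : nat) : \bar R :=
  ereal_inf [set (m%:R)%:E | m in [set m : nat | (0 < m)%N /\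
    forall k : nat, (power (P n) U (alpha n) n <=
                     power (P n) V (alpha n) (m + k))%E]].

Definition intermediate_efficiency (U V : statistic)
    (P : nat -> probability (measurableTypeR R) R) (e : \bar R) : Prop :=
  (exists alpha, admissible U P alpha) /\
  forall alpha, admissible U P alpha ->
    (required_size U V P alpha n * (n%:R^-1)%:E)%E @[n --> \oo] --> e.

End intermediate_efficiency.

Section slopes.
Context {R : realType}.

Definition cM : R := 2.
Definition cK : R := 2.

Definition bM (A : R -> R) (theta : R) (n : nat) : R :=
  Num.sqrt (ln (Num.sqrt n%:R * theta *
    sup [set `|A t| / Num.sqrt (t * (1 - t)) | t in `]0, 1[])).

Definition bK (A : R -> R) (theta : R) (n : nat) : R :=
  Num.sqrt n%:R * theta * sup [set `|A t| | t in `]0, 1[].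

End slopes.

(* Main.v *)
Require Import Defs.
From mathcomp Require Import all_boot all_order all_algebra.
From mathcomp Require Import all_classical all_reals all_analysis.
From mathcomp Require Import measurable_realfun ring lra.

(** The logarithm of [Sstat] is an inefficient statistic because [Sstat] has
    heavy tails under the uniform law [P_0]: a single observation within
    [1 / (n * u ^ 2)] of an end point already gives [Sstat] the size [u], so
    that [P_0 (u < Sstat)] decays only polynomially in [u] and [1 / n]
    ([Sstat_null_lower]). The tails of [Kstat] are exponential
    ([Kstat_null_tail]). At a given level [alpha] the critical value of
    [Kstat] is thus at most of order [ln (j / alpha)] at sample size [j],
    whereas the one of [Sstat] is at least a power of [1 / (n * alpha)].

    Let [alpha] be admissible for [Mstat]. Under [P n] the weighted statistic
    exceeds [n ^ 3] with vanishing probability, because the bound on [A] makes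
    it unlikely that an observation is within [n ^ -4] of an end point
    ([model_Sstat_tail]). As the power does not vanish, the critical value of
    [Mstat] is at most the one that corresponds to [n ^ 3], and the level is
    at least [P_0 (n ^ 3 < Sstat)], which is polynomial in [1 / n]
    ([admissible_level_ge]). The critical value of [Kstat] at sample size [j]
    is then [O (ln j + ln n)]. The condition on [theta] says that
    [sqrt n * theta n] dominates every power of [ln n] ([near_signal] keeps
    the cube), so that for every [e > 0], eventually in [n], the signal
    [sqrt j * theta n * |A t0|] of [Kstat] beats that critical value at all
    sample sizes [j >= e * n] simultaneously ([near_signal_dominates]). The
    power of [Kstat] then exceeds the limit superior of the power of [Mstat],
    which is smaller than one, and the required sample size is at most
    [2 * e * n] ([near_required_size]).

    Admissible levels exist: take for [alpha n] the probability under [P_0]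
    that [Mstat] exceeds its median under [P n]. This median corresponds to a
    value of [Sstat] between a power of [ln n], by the signal in [Kstat], and
    [n ^ 3]; hence [alpha n] tends to zero, by the upper bound
    [Sstat_null_tail] on the tail of [Sstat] under [P_0], but not faster than
    a power of [1 / n]. The power at this level is exactly one half
    ([power_at_level]). This takes two facts on the law of [Sstat]. First, it
    has no atom under [P n] ([Sstat_atomless]): the supremum is reached at an
    observation [X_i], which has to solve one of finitely many equations
    [k / n - t = u * wt t], and the law of [X_i] has no atom since [A] is continuous. Second, [P n]
    may be singular with respect to [P_0], but [Sstat] is continuous on the
    open unit cube, so that an event [s < Sstat < u] that is null under [P_0]
    contains no point of the cube ([Sstat_no_gap]).

    All the exponential bounds come from Chernoff's inequality for
    the empirical distribution function at one point ([edf_tail]), applied on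
    the grid [k / n]; the union bound costs a factor [n], which is harmless
    here since every margin is a power of [ln n]. *)

Set Implicit Arguments.
Unset Strict Implicit.
Unset Printing Implicit Defensive.

Import Order.TTheory GRing.Theory Num.Theory.
Import numFieldNormedType.Exports.

Local Open Scope classical_set_scope.
Local Open Scope ring_scope.

(** * Real-valued probabilities *)

Section real_probability.
Context d (T : measurableType d) (R : realType) (mu : probability T R).
Implicit Types A B : set T.

Definition pr A : R := fine (mu A).

Lemma prE A : measurable A -> mu A = (pr A)%:E.
Proof. by move=> mA; rewrite /pr fineK// fin_num_measure. Qed.

Lemma pr_ge0 A : 0 <= pr A.
Proof. by rewrite fine_ge0// measure_ge0. Qed.

Lemma le_pr A B : measurable A -> measurable B -> A `<=` B -> pr A <= pr B.
Proof.
by move=> mA mB AB; rewrite fine_le ?fin_num_measure// le_measure// inE.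
Qed.

Lemma pr_setT : pr setT = 1.
Proof. by rewrite /pr probability_setT. Qed.

Lemma pr_le1 A : measurable A -> pr A <= 1.
Proof. by move=> mA; rewrite -pr_setT le_pr. Qed.

Lemma pr_set0 : pr set0 = 0.
Proof. by rewrite /pr measure0. Qed.

Lemma pr_setU A B : measurable A -> measurable B -> [disjoint A & B] ->
  pr (A `|` B) = pr A + pr B.
Proof.
move=> mA mB /disj_set2P AB.
by rewrite /pr measureU// fineD// fin_num_measure.
Qed.

Lemma le_pr_setU A B : measurable A -> measurable B ->
  pr (A `|` B) <= pr A + pr B.
Proof.
move=> mA mB; rewrite /pr -fineD ?fin_num_measure//.
rewrite fine_le ?fin_numD ?fin_num_measure//; first exact: measurableU.
exact: measureU2.
Qed.

Lemma pr_setC A : measurable A -> pr (~` A) = 1 - pr A.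
Proof.
move=> mA; rewrite /pr probability_setC// fineB ?fin_num_measure//.
Qed.

Lemma le_pr_bigcup_ord n (F : 'I_n -> set T) (e : R) :
  (forall i, measurable (F i)) -> (forall i, pr (F i) <= e) ->
  pr (\bigcup_(i in [set: 'I_n]) F i) <= n%:R * e.
Proof.
move=> mF Fe.
have -> : \bigcup_(i in [set: 'I_n]) F i = \big[setU/set0]_(i < n) F i.
  rewrite (_ : [set: 'I_n] = [set` 'I_n]) ?bigcup_pred; first exact: eq_bigl.
  by apply/seteqP; split => i //=; rewrite inE.
have -> : n%:R * e = \sum_(i < n) e by rewrite sumr_const card_ord mulr_natl.
suff : measurable (\big[setU/set0]_(i < n) F i) /\
       pr (\big[setU/set0]_(i < n) F i) <= \sum_(i < n) e by case.
elim/big_ind2: _ => [|A a B b [mA Aa] [mB Bb]|i _].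
- by split => //; rewrite pr_set0.
- split; first exact: measurableU.
  by rewrite (le_trans (le_pr_setU mA mB))// lerD.
- by split.
Qed.

End real_probability.

Lemma pr_setX d1 d2 (T1 : measurableType d1) (T2 : measurableType d2)
    (R : realType) (P : probability T1 R) (Q : probability T2 R) A B :
  measurable A -> measurable B ->
  pr (P \x Q)%E (A `*` B) = pr P A * pr Q B.
Proof.
move=> mA mB; have /(congr1 fine) := product_measure1E P Q mA mB.
by rewrite fineM ?fin_num_measure.
Qed.

(** * Product powers *)

Section product_power_lemmas.
Context d (T : measurableType d) (R : realType) (P : probability T R).

Lemma product_powerS n (B : set (n.+1.-tuple T)) :
  product_power P n.+1 B =
  (P \x product_power P n)%E ((@tuple_cons _ T n) @^-1` B).
Proof. by []. Qed.

Definition box n (A : 'I_n -> set T) : set (n.-tuple T) :=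
  [set x | forall i, A i (tnth x i)].

Lemma measurable_box n (A : 'I_n -> set T) :
  (forall i, measurable (A i)) -> measurable (box A).
Proof.
move=> mA.
have -> : box A = \bigcap_(i in [set: 'I_n]) ((@tnth n T)^~ i @^-1` A i).
  by apply/seteqP; split => [x xA i _|x xA i]; [exact: xA|exact: (xA i)].
apply: fin_bigcap_measurable => // i _.
by rewrite -[X in measurable X]setTI; exact: measurable_tnth.
Qed.

(** Peeling off the first coordinate follows the recursion that defines
    [product_power]; independence of the coordinates is only used in this
    form. *)
Lemma pr_box n (A : 'I_n -> set T) : (forall i, measurable (A i)) ->
  pr (product_power P n) (box A) = \prod_(i < n) pr P (A i).
Proof.
elim: n A => [|n IH] A mA.
  rewrite big_ord0 (_ : box A = setT) ?pr_setT//.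
  by apply/seteqP; split => // x _ [].
rewrite /pr product_powerS.
have -> : (@tuple_cons _ T n) @^-1` box A =
    A ord0 `*` box (fun i => A (lift ord0 i)).
  apply/seteqP; split => [[a x] h|[a x] [/= ha hx] i] /=.
    split => [|i]; first by have := h ord0; rewrite /tuple_cons tnth0.
    by have := h (lift ord0 i); rewrite /tuple_cons tnthS.
  rewrite /tuple_cons; case: (unliftP ord0 i) => [j ->|->].
    by rewrite tnthS; exact: hx.
  by rewrite tnth0.
rewrite product_measure1E//; last exact: measurable_box.
rewrite big_ord_recl -IH// fineM//; first exact: fin_num_measure.
by apply: fin_num_measure; exact: measurable_box.
Qed.

Lemma pr_coord n (i : 'I_n) (A : set T) : measurable A ->
  pr (product_power P n) [set x | A (tnth x i)] = pr P A.
Proof.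
move=> mA; pose F j := if j == i then A else setT.
have mF j : measurable (F j) by rewrite /F; case: ifP.
have -> : [set x | A (tnth x i)] = box F.
  apply/seteqP; split => [x xA j|x /(_ i)]; rewrite /F ?eqxx//.
  by case: eqP => // ->.
rewrite pr_box// (bigD1 i)//= /F eqxx big1 ?mulr1// => j /negbTE ->.
exact: pr_setT.
Qed.

Lemma measurable_coord n (i : 'I_n) (A : set T) : measurable A ->
  measurable [set x : n.-tuple T | A (tnth x i)].
Proof.
by move=> mA; rewrite -[X in measurable X]setTI; exact: measurable_tnth.
Qed.

Lemma pr_exists_coord n (A : set T) : measurable A ->
  pr (product_power P n) [set x | exists i, A (tnth x i)] <= n%:R * pr P A.
Proof.
move=> mA.
have -> : [set x : n.-tuple T | exists i, A (tnth x i)] =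
    \bigcup_(i in [set: 'I_n]) [set x | A (tnth x i)].
  by apply/seteqP; split => [x [i xi]|x [i _ xi]]; exists i.
apply: le_pr_bigcup_ord => i; first exact: measurable_coord.
by rewrite pr_coord.
Qed.

Lemma measurable_exists_coord n (A : set T) : measurable A ->
  measurable [set x : n.-tuple T | exists i, A (tnth x i)].
Proof.
move=> mA.
have -> : [set x : n.-tuple T | exists i, A (tnth x i)] =
    \bigcup_(i in [set: 'I_n]) [set x | A (tnth x i)].
  by apply/seteqP; split => [x [i xi]|x [i _ xi]]; exists i.
by apply: fin_bigcup_measurable => // i _; exact: measurable_coord.
Qed.

Definition score_sum (D : set T) (a b : R) n (x : n.-tuple T) : R :=
  \sum_(i < n) (if tnth x i \in D then a else b).

Lemma score_sum_cons D a b n (y : T) (x : n.-tuple T) :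
  score_sum D a b (tuple_cons (y, x)) =
  (if y \in D then a else b) + score_sum D a b x.
Proof.
rewrite /score_sum big_ord_recl /tuple_cons tnth0 /=.
by congr (_ + _); apply: eq_bigr => i _; rewrite tnthS.
Qed.

Lemma measurable_score_sum D a b n : measurable D ->
  measurable_fun setT (@score_sum D a b n).
Proof.
move=> mD; rewrite /score_sum; apply: measurable_sum => i.
apply: measurable_fun_ifT => //.
apply: (measurable_fun_bool true); rewrite setTI.
rewrite (_ : _ @^-1` _ = [set x | D (tnth x i)]); first exact: measurable_coord.
by apply/seteqP; split => x; [move/set_mem|move/mem_set].
Qed.

Lemma measurable_score_ge D a b n c : measurable D ->
  measurable [set x | c <= @score_sum D a b n x].
Proof.
move=> mD; rewrite -[X in measurable X]setTI.
have := @measurable_score_sum D a b n mD => /(_ measurableT _ (measurable_itv `[c, +oo[)).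
congr measurable; apply/seteqP; split=> x [_] /=; rewrite in_itv/= andbT//.
Qed.

(** Chernoff's bound, by induction on the sample size instead of through
    the moment generating function: conditioning on the first observation
    multiplies both sides by the same factor. *)
Lemma chernoff_score D a b n c : measurable D ->
  pr (product_power P n) [set x | c <= @score_sum D a b n x] <=
  expR (- c) * (pr P D * expR a + (1 - pr P D) * expR b) ^+ n.
Proof.
move=> mD; elim: n c => [|n IH] c.
  rewrite expr0 mulr1; have [c0|c0] := leP c 0.
    apply: (@le_trans _ _ 1); first by apply: pr_le1; exact: measurable_score_ge.
    by rewrite -expR0 ler_expR oppr_ge0.
  rewrite (_ : [set _ | _] = set0) ?pr_set0 ?expR_ge0//.
  apply/seteqP; split => // x /=.
  by rewrite /score_sum big_ord0 leNgt c0.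
pose B e := [set x | c - e <= @score_sum D a b n x].
have mB e : measurable (B e) by exact: measurable_score_ge.
have E : (@tuple_cons _ T n) @^-1` [set x | c <= score_sum D a b x] =
    (D `*` B a) `|` (~` D `*` B b).
  apply/seteqP; split => -[y x]; rewrite /B /= score_sum_cons.
    by case: ifPn; rewrite ?inE ?notin_setE => h hc; [left|right]; split=> //=;
      rewrite lerBlDl.
  by case=> -[/= h]; rewrite lerBlDl; [rewrite mem_set//|rewrite memNset].
rewrite {1}/pr product_powerS E -/(pr _ _) pr_setU.
- have mDC := measurableC mD.
  rewrite !pr_setX// pr_setC//.
  apply: (@le_trans _ _ (pr P D * (expR (- (c - a)) *
     (pr P D * expR a + (1 - pr P D) * expR b) ^+ n) + (1 - pr P D) *
     (expR (- (c - b)) * (pr P D * expR a + (1 - pr P D) * expR b) ^+ n))).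
    by apply: lerD; apply: ler_wpM2l; rewrite ?pr_ge0 ?subr_ge0 ?pr_le1//;
      exact: IH.
  rewrite !opprB !(addrC _ (- c)) !expRD exprS.
  set u := _ ^+ n; lra.
- exact: measurableX.
- by apply: measurableX => //; exact: measurableC.
- by apply/disj_set2P/seteqP; split => // -[y x] /= [[h _] [/= h' _]].
Qed.

End product_power_lemmas.


(** * Exponential tails of the empirical distribution function *)

Section edf_tail.
Context {R : realType}.
Implicit Types (P : probability (measurableTypeR R) R) (p l r v t : R).

(** From [1 - x <= expR (- x)], that is [(1 - x) * expR x <= 1]. *)
Lemma expR_le_quadratic (x : R) : x <= 2^-1 -> expR x <= 1 + x + 2 * x ^+ 2.
Proof.
move=> x2; have := expR_ge1Dx (- x); rewrite expRN => h.
have e0 := expR_gt0 x.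
have {}h : (1 - x) * expR x <= 1 by rewrite -ler_pdivlMr// mul1r.
have : 0 <= x ^+ 2 * (1 - 2 * x) by apply: mulr_ge0; [exact: sqr_ge0|lra].
have y0 : 0 < 1 - x by lra.
by move=> h2; rewrite -(ler_pM2l y0); apply: (le_trans h); lra.
Qed.

(** The linear terms cancel because the variable is centered; the quadratic
    terms add up to twice the variance [p * (1 - p)]. *)
Lemma centered_bernoulli_mgf p l : 0 <= p <= 1 -> `|l| <= 2^-1 ->
  p * expR (l * (1 - p)) + (1 - p) * expR (- (l * p)) <=
  expR (2 * l ^+ 2 * (p * (1 - p))).
Proof.
move=> /andP[p0 p1]; rewrite ler_norml => /andP[l1 l2].
apply: le_trans (expR_ge1Dx _).
have h1 : l * (1 - p) <= 2^-1 by nra.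
have h2 : - (l * p) <= 2^-1 by nra.
have p'0 : 0 <= 1 - p by lra.
apply: (le_trans (lerD (ler_wpM2l p0 (expR_le_quadratic h1))
  (ler_wpM2l p'0 (expR_le_quadratic h2)))).
rewrite le_eqVlt; apply/orP; left; apply/eqP; ring.
Qed.

Lemma score_sum_edf t a b n (x : n.-tuple R) : (0 < n)%N ->
  score_sum `]-oo, t] a b x = n%:R * (edf x t * (a - b) + b).
Proof.
move=> n0; have n0' : n%:R != 0 :> R by rewrite pnatr_eq0 -lt0n.
rewrite /score_sum /edf.
rewrite (eq_bigr (fun i => (tnth x i <= t)%R%:R * (a - b) + b)); last first.
  move=> i _; have [xt|xt] := boolP (tnth x i <= t).
    by rewrite mem_set ?mul1r ?subrK//= in_itv.
  by rewrite memNset ?mul0r ?add0r//= in_itv/=; apply/negP.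
rewrite big_split/= -mulr_suml sumr_const card_ord -[b *+ n]mulr_natl.
by set u := \sum_(i < n) _; field.
Qed.

Lemma measurable_edf n t : measurable_fun setT (fun x : n.-tuple R => edf x t).
Proof.
rewrite /edf; apply: measurable_funM => //; apply: measurable_sum => i.
rewrite (_ : (fun _ => _) = (fun x : n.-tuple R => if tnth x i <= t then 1 else 0)).
  apply: measurable_fun_ifT => //.
  apply: measurable_fun_ler => //; exact: measurable_tnth.
by apply/funext => x; case: ifP.
Qed.

Lemma measurable_edf_dev n t p (c : R) :
  measurable [set x : n.-tuple R | c <= `|edf x t - p|].
Proof.
have mf : measurable_fun setT (fun x : n.-tuple R => `|edf x t - p|).
  apply: measurableT_comp => //.
  by apply: measurable_funB => //; exact: measurable_edf.
rewrite -[X in measurable X]setTI.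
have := mf measurableT _ (measurable_itv `[c, +oo[).
by congr measurable; apply/seteqP; split=> x [_] /=; rewrite in_itv/= andbT.
Qed.

(** [v] stands for the standard deviation [sqrt (n p (1 - p))] or an upper
    bound of it; [1 / 2 <= v] keeps the Chernoff parameter [1 / (4 v)] in the
    range where [expR] is bounded by a quadratic. *)
Lemma edf_tail P n t r v : (0 < n)%N -> 2^-1 <= v ->
  n%:R * (pr P `]-oo, t] * (1 - pr P `]-oo, t])) <= v ^+ 2 ->
  pr (product_power P n)
    [set x | r * v <= n%:R * `|edf x t - pr P `]-oo, t]| ] <=
  4 * expR (- (r / 4)).
Proof.
move=> n0 v2 nv; set p := pr P _ in nv *.
have p01 : 0 <= p <= 1 by rewrite pr_ge0 pr_le1.
have v0 : 0 < v by lra.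
pose l := (4 * v)^-1.
have l0 : 0 < l by rewrite invr_gt0 mulr_gt0.
have lv : l * v = 4^-1 by rewrite /l; field; rewrite gt_eqF.
have l2 : l <= 2^-1 by rewrite lef_pV2 ?posrE; lra.
pose E s := [set x : n.-tuple R | r / 4 <=
  score_sum `]-oo, t] (s * l * (1 - p)) (- (s * l * p)) x].
have mE s : measurable (E s) by exact: measurable_score_ge.
have prE s : `|s| = 1 -> pr (product_power P n) (E s) <= 2 * expR (- (r / 4)).
  move=> s1; apply: le_trans; first exact: chernoff_score.
  rewrite -/p mulrC ler_wpM2r ?expR_ge0//.
  have sl : `|s * l| <= 2^-1 by rewrite normrM s1 mul1r gtr0_norm.
  have s2 : s ^+ 2 = 1 by rewrite -[LHS]ger0_norm ?sqr_ge0// normrX s1 expr1n.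
  apply: (@le_trans _ _ (expR (2 * (s * l) ^+ 2 * (p * (1 - p))) ^+ n)).
    rewrite lerXn2r ?nnegrE ?expR_ge0 ?centered_bernoulli_mgf//.
    by case/andP: p01 => *; rewrite addr_ge0// mulr_ge0 ?expR_ge0//; lra.
  rewrite -expRM_natl; apply: (@le_trans _ _ (expR 8^-1)).
    rewrite ler_expR exprMn s2 mul1r.
    have -> : n%:R * (2 * l ^+ 2 * (p * (1 - p))) =
      2 * l ^+ 2 * (n%:R * (p * (1 - p))) by ring.
    apply: (@le_trans _ _ (2 * l ^+ 2 * v ^+ 2)).
      by rewrite ler_wpM2l// mulr_ge0// sqr_ge0.
    by rewrite -mulrA -exprMn lv; lra.
  apply: (le_trans (expR_le_quadratic _)); lra.
have n0' : 0 < n%:R :> R by rewrite ltr0n.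
have sub : [set x | r * v <= n%:R * `|edf x t - p| ] `<=` E 1 `|` E (-1).
  move=> x /=; rewrite /E /= !score_sum_edf// => h.
  have {}h : r / 4 <= l * (n%:R * `|edf x t - p|).
    by rewrite -lv mulrCA ler_wpM2l// ltW.
  have [d0|d0] := leP 0 (edf x t - p).
    by left; apply: (le_trans h); rewrite ger0_norm//; lra.
  by right; apply: (le_trans h); rewrite ltr0_norm//; lra.
apply: (le_trans (le_pr (product_power P n) _ _ sub)).
- rewrite (_ : [set _ | _] = [set x : n.-tuple R |
    r * v / n%:R <= `|edf x t - p| ]); first exact: measurable_edf_dev.
  by apply/seteqP; split => x /=; rewrite ler_pdivrMr// [_ * n%:R]mulrC.
- by apply: measurableU; exact: mE.
apply: (le_trans (le_pr_setU (product_power P n) (mE 1) (mE (-1)))).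
have := prE 1 (normr1 _); have := prE (-1); rewrite normrN1 => /(_ erefl).
by move=> h1 h2; apply: (le_trans (lerD h2 h1)); lra.
Qed.

End edf_tail.

(** * Continuous laws on the unit interval *)

Section continuous_law.
Context {R : realType}.
Implicit Types (P : probability (measurableTypeR R) R) (F : R -> R) (t : R).

(** Continuity of [F] is the only regularity assumed: the laws of the
    alternatives may have no density. *)
Definition law01 P F := [/\ forall t, 0 < t < 1 -> pr P `]-oo, t] = F t,
  {within `[0, 1], continuous F}, F 0 = 0 & F 1 = 1].

Lemma law01_compl P F d : law01 P F -> 0 < d < 2^-1 ->
  pr P (~` `[d, 1 - d]) <= F d + (1 - F (1 - d)).
Proof.
case=> FP _ _ _ /andP[d0 d2]; rewrite -!FP; try by apply/andP; split; lra.
rewrite -pr_setC//; apply: le_trans (le_pr_setU _ _ _) => //; last exact: measurableC.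
apply: le_pr => //; first exact: measurableC.
  by apply: measurableU => //; exact: measurableC.
move=> x /=; rewrite !in_itv/= => /negP; rewrite negb_and -!ltNge.
by move=> /orP[/ltW xd|xd]; [left|right; apply/negP; rewrite -ltNge].
Qed.

(** Let [d] tend to [0] in [law01_compl]. *)
Lemma law01_null P F : law01 P F -> pr P (~` `]0, 1[) = 0.
Proof.
move=> /[dup] PF [FP Fc F0 F1]; apply/eqP; rewrite eq_le pr_ge0 andbT.
have [_ Fr Fl] := (continuous_within_itvP F (@ltr01 R)).1 Fc.
have Fl' : F (1 - d) @[d --> 0^'+] --> (1 : R).
  apply/cvgrPdist_lt => e e0; move: Fl; rewrite F1 => /cvgrPdist_lt /(_ e e0).
  by rewrite nbhs_left0P.
rewrite F0 in Fr.
have : F d + (1 - F (1 - d)) @[d --> 0^'+] --> (0 + (1 - 1) : R).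
  by apply: cvgD => //; apply: cvgB => //; exact: cvg_cst.
rewrite subrr addr0 => h; apply: (cvgr_to_ge h).
near=> d; have d0 : 0 < d by near: d; exact: nbhs_right_gt.
have d2 : d < 2^-1 by near: d; apply: nbhs_right_lt.
apply: le_trans (law01_compl PF _); last by apply/andP.
apply: le_pr; [exact: measurableC|exact: measurableC|].
apply: subsetC => x /=; rewrite !in_itv/= => /andP[h1 h2]; apply/andP; split; lra.
Unshelve. all: by end_near.
Qed.

Lemma law01_atom P F t : law01 P F -> 0 < t < 1 -> pr P [set t] = 0.
Proof.
case=> FP Fc F0 F1 /andP[t0 t1]; apply/eqP; rewrite eq_le pr_ge0 andbT.
have [Fi _ _] := (continuous_within_itvP F (@ltr01 R)).1 Fc.
have Ft : F s @[s --> t^'-] --> F t.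
  by apply: cvg_at_left_filter; apply: Fi; rewrite in_itv/= t0.
have : F t - F s @[s --> t^'-] --> F t - F t by apply: cvgB => //; exact: cvg_cst.
rewrite subrr => h; apply: (cvgr_to_ge h).
near=> s; have s0 : 0 < s by near: s; exact: nbhs_left_gt.
have st : s < t by near: s; exact: nbhs_left_lt.
rewrite -!FP; try by apply/andP; split; lra.
rewrite lerBrDr -pr_setU//.
  apply: le_pr => //; first exact: measurableU.
  by move=> x /=; rewrite !in_itv/= => -[->|] //; lra.
apply/disj_set2P/seteqP; split => // x /= [->]; rewrite in_itv/= leNgt st//.
Unshelve. all: by end_near.
Qed.

End continuous_law.


(** * The weight and the empirical distribution function *)

Section weight.
Context {R : realType}.
Implicit Types (s t c d e : R).

Definition wt t : R := Num.sqrt (t * (1 - t)).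

Lemma wt_ge0 t : 0 <= wt t.
Proof. exact: sqrtr_ge0. Qed.

Lemma wt_gt0 t : 0 < t < 1 -> 0 < wt t.
Proof. by move=> /andP[t0 t1]; rewrite sqrtr_gt0 mulr_gt0// subr_gt0. Qed.

Lemma sqr_wt t : 0 <= t <= 1 -> wt t ^+ 2 = t * (1 - t).
Proof. by move=> /andP[t0 t1]; rewrite sqr_sqrtr// mulr_ge0// subr_ge0. Qed.

Lemma wt_le t : 0 <= t <= 1 -> wt t <= 2^-1.
Proof.
move=> t01; rewrite -ler_sqr ?nnegrE ?wt_ge0//.
by rewrite sqr_wt//; have := sqr_ge0 (t - 2^-1); lra.
Qed.

(** [t * (1 - t)] is [1]-Lipschitz on the unit interval and [Num.sqrt] is
    subadditive. *)
Lemma wt_perturb s t e : 0 <= s <= 1 -> 0 <= t <= 1 -> `|s - t| <= e ->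
  wt s <= wt t + Num.sqrt e.
Proof.
move=> s01 t01 ste; have e0 : 0 <= e := le_trans (normr_ge0 _) ste.
rewrite -ler_sqr ?nnegrE ?wt_ge0//; last by rewrite addr_ge0 ?wt_ge0 ?sqrtr_ge0.
rewrite sqrrD !sqr_wt// sqr_sqrtr//.
have h : 0 <= wt t * Num.sqrt e by rewrite mulr_ge0 ?wt_ge0 ?sqrtr_ge0.
move: s01 t01 ste => /andP[s0 s1] /andP[t0 t1]; rewrite ler_norml => /andP[h1 h2].
have : `|1 - s - t| <= 1 by rewrite ler_norml; apply/andP; split; lra.
have : s * (1 - s) - t * (1 - t) <= `|s - t| * `|1 - s - t|.
  by rewrite -normrM; apply: le_trans (ler_norm _); lra.
have : `|s - t| <= e by rewrite ler_norml; apply/andP; split; lra.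
have := normr_ge0 (s - t); have := normr_ge0 (1 - s - t).
by move: `|s - t| `|1 - s - t| => a b; nra.
Qed.

Lemma wt_ge d t : 0 < d <= 2^-1 -> d <= t <= 1 - d -> Num.sqrt (d / 2) <= wt t.
Proof. by move=> /andP[? ?] /andP[? ?]; rewrite ler_wsqrtr//; nra. Qed.

Lemma wt_left d t : 0 < d <= 2^-1 -> 0 < t <= d -> t <= Num.sqrt (2 * d) * wt t.
Proof.
move=> /andP[? ?] /andP[? ?]; rewrite -sqrtrM; last by lra.
rewrite -ler_sqr ?nnegrE ?sqrtr_ge0//; last by lra.
have h : t <= 2 * d * (1 - t) by nra.
have t0 : 0 <= t by lra.
by rewrite sqr_sqrtr; [rewrite mulrCA expr2 ler_wpM2l|nra].
Qed.

Lemma wtC t : wt (1 - t) = wt t.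
Proof. by rewrite /wt; congr Num.sqrt; ring. Qed.

Lemma wt_right d t : 0 < d <= 2^-1 -> 1 - d <= t < 1 ->
  1 - t <= Num.sqrt (2 * d) * wt t.
Proof.
by move=> d2 /andP[? ?]; rewrite -wtC; apply: wt_left => //; apply/andP; split; lra.
Qed.

(** [(c - t) / wt t] is
    [c * sqrt ((1 - t) / t) - (1 - c) * sqrt (t / (1 - t))], hence strictly
    decreasing. *)
Lemma weighted_dev_decr c s t : 0 <= c <= 1 -> 0 < s -> s < t -> t < 1 ->
  (c - t) * wt s < (c - s) * wt t.
Proof.
move=> /andP[c0 c1] s0 st t1.
rewrite /wt !sqrtrM; [|lra|lra].
set a := Num.sqrt s; set b := Num.sqrt (1 - s).
set a' := Num.sqrt t; set b' := Num.sqrt (1 - t).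
have a0 : 0 < a by rewrite sqrtr_gt0.
have b'0 : 0 < b' by rewrite sqrtr_gt0 subr_gt0.
have aa' : a < a' by rewrite ltr_sqrt//; lra.
have bb' : b' < b by rewrite ltr_sqrt//; lra.
have -> : c - t = c * b' ^+ 2 - (1 - c) * a' ^+ 2 by rewrite !sqr_sqrtr; lra.
have -> : c - s = c * b ^+ 2 - (1 - c) * a ^+ 2 by rewrite !sqr_sqrtr; lra.
rewrite -subr_gt0.
have -> : (c * b ^+ 2 - (1 - c) * a ^+ 2) * (a' * b') -
  (c * b' ^+ 2 - (1 - c) * a' ^+ 2) * (a * b) =
  (b * a' - b' * a) * (c * (b * b') + (1 - c) * (a * a')) by ring.
apply: mulr_gt0.
  by rewrite subr_gt0; apply: ltr_pM => //; exact: ltW.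
have p1 : 0 < b * b' by rewrite mulr_gt0//; lra.
have p2 : 0 < a * a' by rewrite mulr_gt0//; lra.
have [c2|c2] := leP c 2^-1; nra.
Qed.

End weight.

Section edf_facts.
Context {R : realType} (n : nat).
Implicit Types (x y : n.-tuple R) (s t d e r u : R).

Lemma edf_ge0 x t : 0 <= edf x t.
Proof. by rewrite divr_ge0// sumr_ge0. Qed.

Lemma le_edf x y s t : (forall i, tnth x i <= s -> tnth y i <= t) ->
  edf x s <= edf y t.
Proof.
move=> h; rewrite ler_wpM2r ?invr_ge0//; apply: ler_sum => i _.
by rewrite ler_nat; case: leP => // /h ->.
Qed.

Lemma edf_eq0 x t : (forall i, t < tnth x i) -> edf x t = 0.
Proof. by move=> h; rewrite /edf big1 ?mul0r// => i _; rewrite leNgt h. Qed.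

Context (n0 : (0 < n)%N).

Let n0' : 0 < n%:R :> R. Proof. by rewrite ltr0n. Qed.

Lemma edf_eq1 x t : (forall i, tnth x i <= t) -> edf x t = 1.
Proof.
move=> h; rewrite /edf (eq_bigr (fun=> 1)) => [|i _]; last by rewrite h.
by rewrite sumr_const card_ord divff// gt_eqF.
Qed.

Lemma edf_le1 x t : edf x t <= 1.
Proof.
rewrite ler_pdivrMr// mul1r -[leRHS](_ : \sum_(i < n) 1 = _).
  by rewrite ler_sum// => i _; rewrite lern1; case: (_ <= _).
by rewrite sumr_const card_ord.
Qed.

Lemma edf_dev_le1 x t : 0 < t < 1 -> `|edf x t - t| <= 1.
Proof.
move=> /andP[t0 t1]; have := edf_ge0 x t; have := edf_le1 x t.
by move=> h1 h2; rewrite ler_norml; apply/andP; split; lra.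
Qed.

Definition inside d x := forall i, d <= tnth x i <= 1 - d.

(** The empirical distribution function is [0] to the left of the sample and
    [1] to its right. *)
Lemma edf_dev_outside d x t : 0 < d <= 2^-1 -> inside d x -> 0 < t < 1 ->
  ~~ (d <= t <= 1 - d) -> `|edf x t - t| <= Num.sqrt (2 * d) * wt t.
Proof.
move=> d2 xd /andP[t0 t1]; rewrite negb_and -!ltNge => /orP[td|td].
- rewrite edf_eq0; last by move=> i; apply: lt_le_trans td _; case/andP: (xd i).
  rewrite sub0r normrN gtr0_norm//; apply: wt_left => //; lra.
- rewrite edf_eq1; last first.
    by move=> i; apply: le_trans (ltW td); case/andP: (xd i).
  rewrite ger0_norm; last by lra.
  by apply: wt_right => //; lra.
Qed.

Lemma edf_dev_inside d x t : 0 < d <= 2^-1 -> inside d x -> 0 < t < 1 ->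
  `|edf x t - t| <= 2 / Num.sqrt d * wt t.
Proof.
move=> d2 xd t01; have /andP[d0 d1] := d2.
have sd : 0 < Num.sqrt d by rewrite sqrtr_gt0.
have s2 : 0 < Num.sqrt (2^-1 : R) by rewrite sqrtr_gt0.
have s2' : 2^-1 <= Num.sqrt (2^-1 : R).
  by rewrite -ler_sqr ?nnegrE ?sqr_sqrtr; lra.
have [tin|tout] := boolP (d <= t <= 1 - d).
  apply: (le_trans (edf_dev_le1 _ t01)); have := wt_ge d2 tin.
  rewrite sqrtrM; last by lra.
  move=> h; rewrite mulrAC ler_pdivlMr// mul1r; nra.
apply: (le_trans (edf_dev_outside d2 xd t01 tout)).
apply: ler_wpM2r; first exact: wt_ge0.
apply: (@le_trans _ _ 1).
  by rewrite -[leRHS]sqrtr1 ler_wsqrtr//; lra.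
rewrite ler_pdivlMr// mul1r; apply: (@le_trans _ _ 1); last by lra.
by rewrite -[leRHS]sqrtr1 ler_wsqrtr//; lra.
Qed.

(** Points of the open cube are handled through a margin [d], which bounds the
    weighted deviations and makes [Sstat] a genuine supremum. *)
Lemma inside_open x : (forall i, 0 < tnth x i < 1) ->
  exists2 d, 0 < d < 2^-1 & inside d x.
Proof.
move=> x01.
pose d := \big[Num.min/4^-1]_(i < n) Num.min (tnth x i) (1 - tnth x i).
exists d.
  apply/andP; split.
    rewrite /d; elim/big_ind: _ => [|a b a0 b0|i _].
    - by rewrite invr_gt0.
    - by rewrite lt_min a0.
    - by rewrite lt_min subr_gt0 (x01 i).
  apply: (@le_lt_trans _ _ 4^-1); last by lra.
  exact: bigmin_le_id.
move=> i.
have : d <= Num.min (tnth x i) (1 - tnth x i).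
  by rewrite /d (bigD1 i)//= ge_min lexx.
rewrite le_min => /andP[h1 h2]; apply/andP; split; lra.
Qed.

(** * Bounds on the statistics *)

Lemma sqrtn_gt0 : 0 < Num.sqrt n%:R :> R.
Proof. by rewrite sqrtr_gt0. Qed.

Lemma Sstat_le x u :
  (forall t, 0 < t < 1 -> Num.sqrt n%:R * `|edf x t - t| <= u * wt t) ->
  Sstat x <= u.
Proof.
move=> h; rewrite /Sstat mulrC -ler_pdivlMr ?sqrtn_gt0//.
apply: ge_sup.
  by exists (`|edf x 2^-1 - 2^-1| / Num.sqrt (2^-1 * (1 - 2^-1))), 2^-1 => //=;
    rewrite in_itv/=; apply/andP; split; lra.
move=> _ [t + <-]; rewrite /= in_itv/= => t01; rewrite -/(wt t).
rewrite ler_pdivlMr ?sqrtn_gt0// mulrAC ler_pdivrMr ?wt_gt0//.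
by rewrite mulrC; exact: h.
Qed.

Lemma Kstat_le x u :
  (forall t, 0 < t < 1 -> Num.sqrt n%:R * `|edf x t - t| <= u) -> Kstat x <= u.
Proof.
move=> h; rewrite /Kstat mulrC -ler_pdivlMr ?sqrtn_gt0//.
apply: ge_sup.
  by exists (`|edf x 2^-1 - 2^-1|), 2^-1 => //=;
    rewrite in_itv/=; apply/andP; split; lra.
move=> _ [t + <-]; rewrite /= in_itv/= => t01.
by rewrite ler_pdivlMr ?sqrtn_gt0// mulrC; exact: h.
Qed.

Lemma Sstat_ge x t : (forall i, 0 < tnth x i < 1) -> 0 < t < 1 ->
  Num.sqrt n%:R * `|edf x t - t| <= Sstat x * wt t.
Proof.
move=> /inside_open[d d2 xd] t01; rewrite /Sstat -mulrA.
rewrite ler_wpM2l ?sqrtr_ge0// -ler_pdivrMr ?wt_gt0//.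
apply: ub_le_sup; last by exists t => //=; rewrite in_itv.
exists (2 / Num.sqrt d) => _ [s + <-]; rewrite /= in_itv/= => s01.
rewrite ler_pdivrMr ?wt_gt0//; apply: edf_dev_inside => //; lra.
Qed.

Lemma Kstat_ge x t : 0 < t < 1 -> Num.sqrt n%:R * `|edf x t - t| <= Kstat x.
Proof.
move=> t01; rewrite ler_wpM2l ?sqrtr_ge0//.
apply: ub_le_sup; last by exists t => //=; rewrite in_itv.
by exists 1 => _ [s + <-]; rewrite /= in_itv/=; exact: edf_dev_le1.
Qed.

Lemma Kstat_ge0 x : 0 <= Kstat x.
Proof.
have h : 0 < (2^-1 : R) < 1 by apply/andP; split; lra.
by apply: le_trans (Kstat_ge x h); rewrite mulr_ge0 ?sqrtr_ge0.
Qed.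

Lemma Sstat_ge0 x : 0 <= Sstat x.
Proof.
rewrite mulr_ge0 ?sqrtr_ge0//; set E := (X in sup X).
have [[_ hE]|/sup_out->//] := pselect (has_sup E).
have h : 0 < (2^-1 : R) < 1 by apply/andP; split; lra.
apply: (@le_trans _ _ (`|edf x 2^-1 - 2^-1| / Num.sqrt (2^-1 * (1 - 2^-1)))).
  by rewrite mulr_ge0 ?invr_ge0 ?sqrtr_ge0.
by apply: ub_le_sup => //; exists 2^-1 => //=; rewrite in_itv.
Qed.

Lemma Sstat_le_inside d x : 0 < d <= 2^-1 -> inside d x ->
  Sstat x <= Num.sqrt n%:R * (2 / Num.sqrt d).
Proof.
move=> d2 xd; apply: Sstat_le => t t01.
by rewrite -mulrA ler_wpM2l ?sqrtr_ge0//; exact: edf_dev_inside.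
Qed.

(** Near one of the end points [|edf x t - t|] then stays above [1 / (2 n)]
    while the weight vanishes. The supremum is thus infinite, and [sup] takes
    its default value [0]. *)
Lemma Sstat_unbounded x : (exists i, ~~ (0 < tnth x i < 1)) -> Sstat x = 0.
Proof.
case=> i xi; rewrite /Sstat sup_out ?mulr0// => -[_ [M hM]].
have {}hM t : 0 < t < 1 -> `|edf x t - t| <= M * wt t.
  move=> t01; rewrite -ler_pdivrMr ?wt_gt0//; apply: hM.
  by exists t => //=; rewrite in_itv.
pose N : R := n%:R^-1.
have N0 : 0 < N by rewrite invr_gt0.
have N1 : N <= 1 by rewrite invf_le1// ler1n.
have M0 : 0 <= M.
  have h : 0 < (2^-1 : R) < 1 by apply/andP; split; lra.
  by have := le_trans (normr_ge0 _) (hM _ h); rewrite pmulr_lge0// wt_gt0.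
(* distance to the end point at which [M * wt e] falls below [1 / (2 n)] *)
pose e := N ^+ 2 / (4 * (1 + M) ^+ 2).
have M1 : 1 <= (1 + M) ^+ 2 by rewrite -[leLHS](expr1n _ 2) lerXn2r ?nnegrE; lra.
have e0 : 0 < e by rewrite divr_gt0 ?exprn_gt0//; lra.
have eN : e <= N / 4.
  rewrite /e expr2 ler_pdivrMr; last by lra.
  have : N * N <= N by nra.
  move: (N * N) => NN hNN; have : N <= N * (1 + M) ^+ 2 by rewrite ler_peMr// ltW.
  by lra.
have we : M * Num.sqrt e < N / 2.
  have -> : e = (N / (2 * (1 + M))) ^+ 2 by rewrite /e; field; rewrite gt_eqF//; lra.
  have M1' : 0 < 1 + M by lra.
  rewrite sqrtr_sqr gtr0_norm; last by rewrite divr_gt0// mulr_gt0.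
  rewrite mulrA ltr_pdivrMr ?mulr_gt0//; nra.
have wt_e t : 0 < t < 1 -> t * (1 - t) <= e -> M * wt t < N / 2.
  by move=> t01 te; apply: le_lt_trans we; rewrite ler_wpM2l// ler_wsqrtr.
have edfN t : tnth x i <= t -> N <= edf x t.
  move=> xt; rewrite /edf (bigD1 i)//= xt mulrDl mul1r lerDl.
  by rewrite divr_ge0// sumr_ge0.
have edfN1 t : t < tnth x i -> edf x t <= 1 - N.
  move=> xt; rewrite /edf ler_pdivrMr// mulrBl mul1r mulVf ?gt_eqF//.
  rewrite (bigD1 i)//= [tnth x i <= t]leNgt xt add0r.
  have -> : n%:R - 1 = \sum_(j < n | j != i) 1 :> R.
    rewrite sumr_const; have := cardC1 i; rewrite card_ord => h.
    rewrite (_ : #|_| = n.-1); last by rewrite -h; apply: eq_card.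
    by rewrite -subn1 natrB.
  by apply: ler_sum => j _; rewrite lern1; case: (_ <= _).
move: xi; rewrite negb_and -!leNgt => /orP[xi|xi].
- have t01 : 0 < e < 1 by apply/andP; split; lra.
  have := hM _ t01; apply/negP; rewrite -ltNge.
  apply: (lt_le_trans (wt_e _ t01 _)); first by nra.
  apply: le_trans (ler_norm _); have := edfN e; have : tnth x i <= e by lra.
  by move=> h /(_ h); lra.
- have t01 : 0 < 1 - e < 1 by apply/andP; split; lra.
  have := hM _ t01; apply/negP; rewrite -ltNge.
  apply: (lt_le_trans (wt_e _ t01 _)); first by nra.
  rewrite distrC; apply: le_trans (ler_norm _).
  have := edfN1 (1 - e); have : 1 - e < tnth x i by lra.
  by move=> h /(_ h); lra.
Qed.

(** Controlling the empirical distribution function on the grid [k / n] is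
    enough: between grid points it is monotone, which costs [1 / n], that is
    [1 / sqrt n] in the scale of the statistics. *)
Lemma edf_dev_grid x r t : (forall i, 0 < tnth x i < 1) -> 0 <= r ->
  (forall k : 'I_n, (0 < k)%N -> n%:R * `|edf x (k%:R / n%:R) - k%:R / n%:R| <=
     r * (Num.sqrt n%:R * wt (k%:R / n%:R))) ->
  0 < t < 1 ->
  n%:R * `|edf x t - t| <= r * Num.sqrt n%:R * wt t + r + 1.
Proof.
move=> x01 r0 hk /andP[t0 t1].
have sn := sqrtn_gt0; have nn := n0'.
have hk' k : (k <= n)%N -> n%:R * `|edf x (k%:R / n%:R) - k%:R / n%:R| <=
     r * (Num.sqrt n%:R * wt (k%:R / n%:R)).
  have rhs0 : 0 <= r * (Num.sqrt n%:R * wt (k%:R / n%:R)).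
    by rewrite !mulr_ge0 ?wt_ge0// ltW.
  rewrite leq_eqVlt => /orP[/eqP kn|kn].
    rewrite kn divff ?gt_eqF// edf_eq1 ?subrr ?normr0 ?mulr0; last first.
      by move=> i; have /andP[_ /ltW] := x01 i.
    by rewrite !mulr_ge0 ?wt_ge0// ltW.
  case: k kn rhs0 => [|k] kn rhs0; last exact: (hk (Ordinal kn)).
  move: rhs0; rewrite mul0r edf_eq0 => [|i]; last by case/andP: (x01 i).
  by rewrite subrr normr0 mulr0.
have hk2 k s : (k <= n)%N -> `|k%:R / n%:R - s| <= n%:R^-1 -> 0 <= s <= 1 ->
    n%:R * `|edf x (k%:R / n%:R) - k%:R / n%:R| <= r * Num.sqrt n%:R * wt s + r.
  move=> kn ks s01; apply: (le_trans (hk' k kn)).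
  have := wt_perturb _ s01 ks; rewrite sqrtrV ?ler0n// => /(_ _) h.
  have {}h : wt (k%:R / n%:R) <= wt s + (Num.sqrt n%:R)^-1.
    by apply: h; rewrite divr_ge0//= ler_pdivrMr// mul1r ler_nat.
  rewrite -[X in _ + X](mulr1 r) -mulrA -mulrDr ler_wpM2l//.
  rewrite -[X in _ + X](divff (lt0r_neq0 sn)) -mulrDr ler_wpM2l// ltW//.
pose k := Num.truncn (n%:R * t).
have nt0 : 0 <= n%:R * t by rewrite mulr_ge0// ltW.
have /andP[k1 k2] : k%:R <= n%:R * t < k.+1%:R by exact: truncn_itv.
have kn : (k < n)%N.
  by rewrite -(ltr_nat R); apply: (le_lt_trans k1); rewrite gtr_pMr.
have d1 : k%:R / n%:R <= t by rewrite ler_pdivrMr// mulrC.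
have d2 : t <= k.+1%:R / n%:R by rewrite ler_pdivlMr// mulrC ltW.
have d3 : k.+1%:R / n%:R = k%:R / n%:R + n%:R^-1 :> R by rewrite -natr1 mulrDl mul1r.
have t01 : 0 <= t <= 1 by rewrite !ltW.
have e1 : edf x (k%:R / n%:R) <= edf x t.
  by apply: le_edf => i h; exact: le_trans d1.
have e2 : edf x t <= edf x (k.+1%:R / n%:R).
  by apply: le_edf => i h; exact: le_trans d2.
have a1 := hk2 k t (ltnW kn).
have a2 := hk2 k.+1 t kn.
have {}a1 : n%:R * `|edf x (k%:R / n%:R) - k%:R / n%:R| <= r * Num.sqrt n%:R * wt t + r.
  by apply: a1 => //; rewrite ler_norml; apply/andP; split; lra.
have {}a2 : n%:R * `|edf x (k.+1%:R / n%:R) - k.+1%:R / n%:R| <= r * Num.sqrt n%:R * wt t + r.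
  by apply: a2 => //; rewrite ler_norml; apply/andP; split; lra.
set C := r * _ * _ in a1 a2 *.
have nV : n%:R * n%:R^-1 = 1 :> R by rewrite mulfV// gt_eqF.
have b1 : n%:R * (k%:R / n%:R - edf x (k%:R / n%:R)) <= C + r.
  by apply: le_trans a1; rewrite ler_pM2l// distrC ler_norm.
have b2 : n%:R * (edf x (k.+1%:R / n%:R) - k.+1%:R / n%:R) <= C + r.
  by apply: le_trans a2; rewrite ler_pM2l// ler_norm.
have -> : n%:R * `|edf x t - t| = `|n%:R * (edf x t - t)|.
  by rewrite normrM ger0_norm// ltW.
rewrite ler_norml; apply/andP; split.
  have : n%:R * (t - edf x t) <= n%:R * (k%:R / n%:R + n%:R^-1 - edf x (k%:R / n%:R)).
    by rewrite ler_pM2l//; lra.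
  by lra.
have : n%:R * (edf x t - t) <= n%:R * (edf x (k.+1%:R / n%:R) - k.+1%:R / n%:R + n%:R^-1).
  by rewrite ler_pM2l//; lra.
by lra.
Qed.

End edf_facts.


(** * Measurability of the statistics *)

Section measurability.
Context {R : realType} (n : nat) (n0 : (0 < n)%N).
Implicit Types (x y : n.-tuple R) (s t d e r u : R).

Lemma edf_right_cst x t :
  exists2 e, 0 < e & forall s, t <= s -> s < t + e -> edf x s = edf x t.
Proof.
pose e := \big[Num.min/1]_(i < n | t < tnth x i) (tnth x i - t).
exists e.
  rewrite /e; elim/big_ind: _ => [//|a b a0 b0|i ti].
    by rewrite lt_min a0.
  by rewrite subr_gt0.
move=> s ts se; apply/eqP; rewrite eq_le; apply/andP; split; apply: le_edf => i.
  move=> xs; rewrite leNgt; apply/negP => tx.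
  have : e <= tnth x i - t by rewrite /e (bigD1 i)//= ge_min lexx.
  by move=> h; lra.
by move=> h; exact: le_trans ts.
Qed.

(** Right continuity lets rational points decide an upper bound; the modulus
    of continuity required of [w] is that of both weights in use, [wt] and
    the constant [1]. *)
Lemma edf_dev_rational (w : R -> R) x u : 0 <= u ->
  (forall s t, 0 < s < 1 -> 0 < t < 1 -> w s <= w t + Num.sqrt `|s - t|) ->
  (forall q : rat, 0 < (ratr q : R) < 1 ->
     Num.sqrt n%:R * `|edf x (ratr q) - ratr q| <= u * w (ratr q)) ->
  forall t, 0 < t < 1 -> Num.sqrt n%:R * `|edf x t - t| <= u * w t.
Proof.
move=> u0 hw hq t t01; have /andP[t0 t1] := t01.
apply/ler_addgt0Pr => h h0.
have sn := @sqrtn_gt0 R n n0.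
have [e1 e10 edfc] := edf_right_cst x t.
pose C := u + Num.sqrt n%:R.
have C0 : 0 < C by rewrite /C; lra.
(* replacing [t] by [q] costs at most [C * sqrt (q - t)] *)
pose e2 := (h / C) ^+ 2.
have e20 : 0 < e2 by rewrite exprn_gt0// divr_gt0.
pose e := Num.min (Num.min e1 e2) (1 - t).
have e0 : 0 < e by rewrite !lt_min e10 e20 subr_gt0.
have tte : t < t + e by rewrite ltrDl.
have [q] := rat_in_itvoo tte.
rewrite in_itv/= => /andP[tq qe].
have [ee1 ee2 et] : [/\ e <= e1, e <= e2 & e <= 1 - t].
  by rewrite /e !ge_min !lexx !orbT.
have q01 : 0 < (ratr q : R) < 1 by apply/andP; split; lra.
have := hq q q01; rewrite edfc; [|by lra|by lra] => hqt.
set z : R := ratr q in tq qe q01 hqt.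
have zt : `|z - t| = z - t by rewrite ger0_norm//; lra.
have := hw z t q01 t01; rewrite zt.
set r := Num.sqrt (z - t).
have r0 : 0 <= r by exact: sqrtr_ge0.
have rr : r ^+ 2 = z - t by rewrite sqr_sqrtr//; lra.
have rC : r * C <= h.
  rewrite -ler_pdivlMr//; rewrite -ler_sqr ?nnegrE// ?rr.
    by rewrite -/e2; lra.
  by rewrite divr_ge0 ?ltW.
have r1 : r <= 1 by rewrite -ler_sqr ?nnegrE// rr expr1n; lra.
have zr : z - t <= r by rewrite -rr expr2 ler_piMl.
move=> hwz.
have d1 : `|edf x t - t| <= `|edf x t - z| + (z - t).
  have -> : edf x t - t = (edf x t - z) + (z - t) by ring.
  by apply: (le_trans (ler_normD _ _)); rewrite zt.
have d2 : Num.sqrt n%:R * `|edf x t - t| <=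
    Num.sqrt n%:R * `|edf x t - z| + Num.sqrt n%:R * r.
  by rewrite -mulrDr ler_pM2l//; lra.
have d3 : u * w z <= u * w t + u * r by rewrite -mulrDr ler_wpM2l.
have : u * r + Num.sqrt n%:R * r <= h by rewrite -mulrDl mulrC.
lra.
Qed.

Definition unit_cube : set (n.-tuple R) := [set x | forall i, 0 < tnth x i < 1].

Lemma unit_cubeE :
  unit_cube = box (fun _ : 'I_n => `]0%R, 1%R[%classic : set (measurableTypeR R)).
Proof.
by apply/seteqP; split => x h i; have := h i; rewrite /= in_itv.
Qed.

Lemma measurable_unit_cube : measurable (unit_cube : set (n.-tuple (measurableTypeR R))).
Proof. by rewrite unit_cubeE; apply: measurable_box => i. Qed.

Lemma measurable_rational_exceed (w : R -> R) u :
  measurable ([set x | exists2 q : rat, 0 < (ratr q : R) < 1 &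
    u * w (ratr q) < Num.sqrt n%:R * `|edf x (ratr q) - ratr q| ]
    : set (n.-tuple (measurableTypeR R))).
Proof.
have sn := @sqrtn_gt0 R n n0.
pose F (q : rat) : set (n.-tuple (measurableTypeR R)) :=
  if 0 < (ratr q : R) < 1 then
    ~` [set x | - (u * w (ratr q) / Num.sqrt n%:R) <= - `|edf x (ratr q) - ratr q| ]
  else set0.
rewrite (_ : [set _ | _] = \bigcup_q F q).
  apply: bigcupT_measurable_rat => q; rewrite /F; case: ifP => // _.
  apply: measurableC.
  have mf : measurable_fun setT (fun x : n.-tuple (measurableTypeR R) =>
     - `|edf x (ratr q) - ratr q|).
    apply: measurableT_comp => //; apply: measurableT_comp => //.
    by apply: measurable_funB => //; exact: measurable_edf.
  rewrite -[X in measurable X]setTI.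
  set c := - (_ / _).
  have := mf measurableT _ (measurable_itv `[c, +oo[).
  by congr measurable; apply/seteqP; split=> x [_] /=; rewrite in_itv/= andbT.
apply/seteqP; split => x /=.
  move=> [q q01 h]; exists q => //; rewrite /F q01 /=; apply/negP.
  by rewrite lerN2 -ltNge ltr_pdivrMr// [_ * Num.sqrt n%:R]mulrC.
move=> [q _]; rewrite /F; case: ifP => //= q01 /negP.
rewrite lerN2 -ltNge ltr_pdivrMr// [_ * Num.sqrt n%:R]mulrC => h; by exists q.
Qed.

Lemma Sstat_gtE u : 0 <= u ->
  [set x : n.-tuple R | u < Sstat x] = unit_cube `&`
  [set x | exists2 q : rat, 0 < (ratr q : R) < 1 &
    u * wt (ratr q) < Num.sqrt n%:R * `|edf x (ratr q) - ratr q| ].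
Proof.
move=> u0; apply/seteqP; split => x /=; last first.
  move=> [x01 [q q01 h]]; rewrite -(ltr_pM2r (wt_gt0 q01)).
  by apply: (lt_le_trans h); exact: Sstat_ge.
have [x01|/existsNP[i /negP xi]] := pselect (unit_cube x); last first.
  by rewrite Sstat_unbounded//; [rewrite ltNge u0|exists i].
move=> uS; split=> //; apply: contrapT => h; move: uS; apply/negP; rewrite -leNgt.
apply: Sstat_le => //; apply: edf_dev_rational => //.
  move=> s t /andP[? ?] /andP[? ?]; apply: wt_perturb => //; apply/andP; split; exact: ltW.
move=> q q01; rewrite leNgt; apply/negP => h'; apply: h; by exists q.
Qed.

Lemma Kstat_gtE u : 0 <= u ->
  [set x : n.-tuple R | u < Kstat x] =
  [set x | exists2 q : rat, 0 < (ratr q : R) < 1 &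
    u * 1 < Num.sqrt n%:R * `|edf x (ratr q) - ratr q| ].
Proof.
move=> u0; apply/seteqP; split => x /=; last first.
  by move=> [q q01]; rewrite mulr1 => h; apply: (lt_le_trans h); exact: Kstat_ge.
move=> uS; apply: contrapT => h; move: uS; apply/negP; rewrite -leNgt.
apply: Kstat_le => // t t01; rewrite -[leRHS]mulr1.
apply: (@edf_dev_rational (fun=> 1)) => //.
  by move=> s t' _ _; rewrite lerDl sqrtr_ge0.
move=> q q01; rewrite leNgt; apply/negP => h'; apply: h; by exists q.
Qed.

Lemma measurable_Sstat_gt u :
  measurable ([set x | u < Sstat x] : set (n.-tuple (measurableTypeR R))).
Proof.
have [u0|u0] := leP 0 u.
  rewrite Sstat_gtE//; apply: measurableI; first exact: measurable_unit_cube.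
  exact: (@measurable_rational_exceed wt).
rewrite (_ : [set _ | _] = setT)//; apply/seteqP; split => // x _ /=.
exact: lt_le_trans (Sstat_ge0 _).
Qed.

Lemma measurable_Kstat_gt u :
  measurable ([set x | u < Kstat x] : set (n.-tuple (measurableTypeR R))).
Proof.
have [u0|u0] := leP 0 u.
  by rewrite Kstat_gtE//; exact: (@measurable_rational_exceed (fun=> 1)).
rewrite (_ : [set _ | _] = setT)//; apply/seteqP; split => // x _ /=.
exact: lt_le_trans (Kstat_ge0 n0 _).
Qed.

End measurability.


(** * Continuity of the law of the weighted statistic *)

Section Sstat_regularity.
Context {R : realType} (n : nat) (n0 : (0 < n)%N).
Implicit Types (x y : n.-tuple R) (s t d e r u v : R).

(** Moving the observations by at most [e] shifts the empirical distribution
    function by at most [e] horizontally. *)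
Lemma Sstat_perturb d e x y : 0 < d <= 2^-1 -> 0 <= e < d ->
  inside d x -> inside d y -> (forall i, `|tnth x i - tnth y i| <= e) ->
  Sstat y <= Sstat x + (Sstat x + Num.sqrt n%:R) * Num.sqrt e / Num.sqrt (d / 2).
Proof.
move=> d2 /andP[e0 ed] xd yd xye; have /andP[d0 d1] := d2.
have sn := @sqrtn_gt0 R n n0.
have Sx0 := Sstat_ge0 x.
have re0 : 0 <= Num.sqrt e by exact: sqrtr_ge0.
have ee : e <= Num.sqrt e.
  by rewrite -ler_sqr ?nnegrE// sqr_sqrtr// expr2 ler_piMl//; lra.
have sd : 0 < Num.sqrt (d / 2) by rewrite sqrtr_gt0; lra.
have x01 i : 0 < tnth x i < 1.
  by have /andP[? ?] := xd i; apply/andP; split; lra.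
set D := (Sstat x + Num.sqrt n%:R) * Num.sqrt e.
have D0 : 0 <= D by rewrite mulr_ge0// addr_ge0// ltW.
apply: Sstat_le => // t t01; have /andP[t0 t1] := t01.
rewrite mulrDl.
have hS s : 0 < s < 1 -> Num.sqrt n%:R * `|edf x s - s| <= Sstat x * wt s.
  by move=> s01; exact: Sstat_ge.
have [tin|tout] := boolP (d <= t <= 1 - d); last first.
  suff -> : edf y t = edf x t.
    by apply: (le_trans (hS _ t01)); rewrite lerDl mulr_ge0 ?wt_ge0// divr_ge0// ltW.
  move: tout; rewrite negb_and -!ltNge => /orP[td|td].
    by rewrite !edf_eq0// => i; apply: lt_le_trans td _;
      [case/andP: (xd i)|case/andP: (yd i)].
  by rewrite !edf_eq1// => i; apply: le_trans (ltW td);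
    [case/andP: (xd i)|case/andP: (yd i)].
have /andP[td td'] := tin.
have wd : D <= D / Num.sqrt (d / 2) * wt t.
  rewrite -mulrA ler_peMr// mulrC ler_pdivlMr// mul1r.
  exact: wt_ge.
apply: (@le_trans _ _ (Sstat x * wt t + D)); last by lra.
have hshift s : `|s - t| <= e -> 0 < s < 1 ->
    Num.sqrt n%:R * `|edf x s - s| <= Sstat x * wt t + Sstat x * Num.sqrt e.
  move=> se /[dup] s01 /andP[? ?]; apply: (le_trans (hS s s01)).
  by rewrite -mulrDr ler_wpM2l// wt_perturb//; apply/andP; split; exact: ltW.
have up : edf y t <= edf x (t + e).
  by apply: le_edf => i; have := xye i; rewrite ler_norml => /andP[? ?]; lra.
have dn : edf x (t - e) <= edf y t.
  by apply: le_edf => i; have := xye i; rewrite ler_norml => /andP[? ?]; lra.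
have h1 : Num.sqrt n%:R * `|edf x (t + e) - (t + e)| <= Sstat x * wt t + Sstat x * Num.sqrt e.
  apply: hshift; last by apply/andP; split; lra.
  by rewrite addrAC subrr add0r ger0_norm.
have h2 : Num.sqrt n%:R * `|edf x (t - e) - (t - e)| <= Sstat x * wt t + Sstat x * Num.sqrt e.
  apply: hshift; last by apply/andP; split; lra.
  by rewrite addrAC subrr add0r normrN ger0_norm.
have ne : Num.sqrt n%:R * e <= Num.sqrt n%:R * Num.sqrt e by rewrite ler_pM2l.
have -> : Num.sqrt n%:R * `|edf y t - t| = `|Num.sqrt n%:R * (edf y t - t)|.
  by rewrite normrM (ger0_norm (ltW sn)).
rewrite ler_norml; apply/andP; split.
- have : Num.sqrt n%:R * (t - edf y t) <= Num.sqrt n%:R * (`|edf x (t - e) - (t - e)| + e).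
    rewrite ler_pM2l//; have := ler_norm (- (edf x (t - e) - (t - e))).
    by rewrite normrN; lra.
  by rewrite /D; lra.
- have : Num.sqrt n%:R * (edf y t - t) <= Num.sqrt n%:R * (`|edf x (t + e) - (t + e)| + e).
    by rewrite ler_pM2l//; have := ler_norm (edf x (t + e) - (t + e)); lra.
  by rewrite /D; lra.
Qed.

(** Between observations the weighted deviation is monotone, so that the
    supremum is reached, possibly as a left limit, at an observation. *)
Lemma Sstat_attained x u : unit_cube x -> 0 < u -> Sstat x = u ->
  exists i (k : 'I_n.+1),
    Num.sqrt n%:R * (k%:R / n%:R - tnth x i) = u * wt (tnth x i) \/
    Num.sqrt n%:R * (k%:R / n%:R - tnth x i) = - u * wt (tnth x i).
Proof.
move=> x01 u0 Su; apply: contrapT => hne.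
have sn := @sqrtn_gt0 R n n0.
have nn : 0 < n%:R :> R by rewrite ltr0n.
pose F i := edf x (tnth x i).
pose G i : R := (\sum_(j < n) (tnth x j < tnth x i)%R%:R) / n%:R.
have countE (p : pred 'I_n) : exists k : 'I_n.+1,
    (\sum_(j < n) (p j)%:R : R) / n%:R = k%:R / n%:R.
  have kn : (\sum_(j < n) p j < n.+1)%N.
    rewrite ltnS -[leqRHS]card_ord -sum1_card; apply: leq_sum => j _.
    by case: (p j).
  by exists (Ordinal kn) => /=; rewrite natr_sum.
have FE i : exists k : 'I_n.+1, F i = k%:R / n%:R by exact: countE.
have GE i : exists k : 'I_n.+1, G i = k%:R / n%:R by exact: countE.
pose f i := Num.sqrt n%:R * (F i - tnth x i) / wt (tnth x i).
pose g i := Num.sqrt n%:R * (tnth x i - G i) / wt (tnth x i).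
have w0 i : 0 < wt (tnth x i) by apply: wt_gt0; exact: x01.
have fu i : f i < u.
  rewrite lt_neqAle; apply/andP; split.
    apply/eqP => fi; apply: hne; have [k Fk] := FE i; exists i, k; left.
    by rewrite -Fk -fi /f mulfVK// gt_eqF.
  rewrite ler_pdivrMr// -Su; apply: le_trans (Sstat_ge n0 x01 (x01 i)).
  by rewrite ler_pM2l// ler_norm.
have gu i : g i < u.
  rewrite lt_neqAle; apply/andP; split.
    apply/eqP => gi; apply: hne; have [k Gk] := GE i; exists i, k; right.
    by rewrite mulNr -Gk -gi /g mulfVK ?gt_eqF//; ring.
  have xi := x01 i; have /andP[xi0 xi1] := xi.
  rewrite ler_pdivrMr//; apply/ler_addgt0Pr => h h0.
  (* the value [g i] is approached at points slightly to the left of the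
     observation *)
  pose C := u + Num.sqrt n%:R.
  have C0 : 0 < C by rewrite /C; lra.
  pose e := Num.min ((h / C) ^+ 2) (Num.min 1 (tnth x i / 2)).
  have e0 : 0 < e by rewrite !lt_min exprn_gt0 ?divr_gt0//= ltr01.
  have [e1 e2 e3] : [/\ e <= (h / C) ^+ 2, e <= 1 & e <= tnth x i / 2].
    by rewrite /e !ge_min !lexx !orbT.
  have t01 : 0 < tnth x i - e < 1 by apply/andP; split; lra.
  have := Sstat_ge n0 x01 t01; rewrite Su.
  have eG : edf x (tnth x i - e) <= G i.
    rewrite ler_wpM2r ?invr_ge0//; apply: ler_sum => j _; rewrite ler_nat.
    have [hj|//] := leP (tnth x j) (tnth x i - e).
    by rewrite (_ : tnth x j < tnth x i)//; lra.
  have we : wt (tnth x i - e) <= wt (tnth x i) + Num.sqrt e.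
    apply: wt_perturb; [by apply/andP; split; lra|by apply/andP; split; lra|].
    by rewrite addrAC subrr add0r normrN gtr0_norm.
  have r0 : 0 <= Num.sqrt e by exact: sqrtr_ge0.
  have rr : Num.sqrt e ^+ 2 = e by rewrite sqr_sqrtr// ltW.
  set r := Num.sqrt e in we r0 rr.
  have rC : r * C <= h.
    by rewrite -ler_pdivlMr// -ler_sqr ?nnegrE// ?rr// divr_ge0 ?ltW.
  have r1 : r <= 1 by rewrite -ler_sqr ?nnegrE// rr expr1n.
  have er : e <= r by rewrite -rr expr2 ler_piMl.
  move=> hS.
  have d1 : Num.sqrt n%:R * (tnth x i - G i - r) <=
      Num.sqrt n%:R * `|edf x (tnth x i - e) - (tnth x i - e)|.
    rewrite ler_pM2l//; have := ler_norm (- (edf x (tnth x i - e) - (tnth x i - e))).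
    by rewrite normrN; lra.
  have d2 : u * wt (tnth x i - e) <= u * (wt (tnth x i) + r) by rewrite ler_pM2l.
  have d3 : u * r + Num.sqrt n%:R * r <= h by rewrite -mulrDl mulrC.
  by lra.
pose v := \big[Num.max/0]_(i < n) Num.max (f i) (g i).
have v0 : 0 <= v by exact: bigmax_ge_id.
have vu : v < u by apply/bigmax_ltP; split => // i _; rewrite gt_max fu gu.
have fv i : f i <= v.
  by apply: (le_trans _ (le_bigmax _ _ i)); rewrite le_max lexx.
have gv i : g i <= v.
  by apply: (le_trans _ (le_bigmax _ _ i)); rewrite le_max lexx orbT.
suff : Sstat x <= v by rewrite Su leNgt vu.
apply: Sstat_le => // t t01; have /andP[t0 t1] := t01.
have wt0 := wt_gt0 t01.
have e01 : 0 <= edf x t <= 1 by rewrite edf_ge0 edf_le1.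
have vw : 0 <= v * wt t by rewrite mulr_ge0// ltW.
have -> : Num.sqrt n%:R * `|edf x t - t| = `|Num.sqrt n%:R * (edf x t - t)|.
  by rewrite normrM (ger0_norm (ltW sn)).
rewrite ler_norml; apply/andP; split.
- have [/existsP[i0 ti0]|/existsPn hn] := boolP [exists i, t < tnth x i]; last first.
    rewrite edf_eq1// => [|i]; last by rewrite leNgt.
    by apply: (@le_trans _ _ 0); [lra|rewrite mulr_ge0 ?ltW//; lra].
  have [i ti imin] := @arg_minP _ _ _ i0 (fun i => t < tnth x i) (tnth x) ti0.
  have Gi : G i = edf x t.
    rewrite /G /edf; congr (_ / _); apply: eq_bigr => j _; congr (nat_of_bool _)%:R.
    apply/idP/idP => [hj|hj]; last exact: le_lt_trans ti.
    by rewrite leNgt; apply/negP => /imin; rewrite leNgt hj.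
  have := gv i; rewrite /g Gi ler_pdivrMr// => hi.
  have /andP[_ xi1] := x01 i.
  have := weighted_dev_decr e01 t0 ti xi1.
  rewrite -(ltr_pM2l sn) => /ltW h.
  rewrite -(ler_pM2r (w0 i)).
  have : v * wt (tnth x i) * wt t >= Num.sqrt n%:R * (tnth x i - edf x t) * wt t.
    by rewrite ler_pM2r.
  by lra.
- have [/existsP[i0 ti0]|/existsPn hn] := boolP [exists i, tnth x i <= t]; last first.
    rewrite edf_eq0 => [|i]; last by rewrite ltNge.
    by apply: (@le_trans _ _ 0) => //; rewrite pmulr_rle0//; lra.
  have [i ti imax] := @arg_maxP _ _ _ i0 (fun i => tnth x i <= t) (tnth x) ti0.
  have Fi : F i = edf x t.
    rewrite /F /edf; congr (_ / _); apply: eq_bigr => j _; congr (nat_of_bool _)%:R.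
    apply/idP/idP => [hj|/imax//]; exact: le_trans ti.
  have := fv i; rewrite /f Fi ler_pdivrMr// => hi.
  have /andP[xi0 xi1] := x01 i.
  move: ti; rewrite le_eqVlt => /orP[/eqP e|ti]; first by rewrite -e in hi *.
  have := weighted_dev_decr e01 xi0 ti t1.
  rewrite -(ltr_pM2l sn) => /ltW h.
  rewrite -(ler_pM2r (w0 i)).
  have : v * wt (tnth x i) * wt t >= Num.sqrt n%:R * (edf x t - tnth x i) * wt t.
    by rewrite ler_pM2r.
  by lra.
Qed.

End Sstat_regularity.


(** * Laws of the statistics *)

Section laws.
Context {R : realType}.
Implicit Types (P : probability (measurableTypeR R) R) (F : R -> R).
Implicit Types (c d r t u : R).

(** The null hypothesis is the case of the identity. *)
Lemma law01_unif : law01 (@unif01 R) id.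
Proof.
split => //; last by apply: continuous_subspaceT => x; exact: cvg_id.
move=> t /andP[t0 t1].
transitivity (fine (\int[lebesgue_measure]_(x in `]-oo, t])
  (uniform_pdf 0 1 x)%:E)%E) => //.
rewrite integral_uniform_pdf.
rewrite (_ : _ `&` _ = `[0%R, t]%classic); last first.
  apply/seteqP; split => x /=; rewrite !in_itv/=; first by move=> [-> /andP[-> _]].
  by move=> /andP[-> xt]; rewrite xt; split => //; lra.
rewrite (eq_integral (cst 1%E)) => [|x].
  rewrite integral_cst// mul1e [X in fine X](lebesgue_measure_itv `[0%R, t])/=.
  by rewrite lte_fin t0 oppr0 adde0.
rewrite inE/= in_itv/= => /andP[x0 xt]; rewrite /uniform_pdf subr0 invr1 x0/=.
by rewrite (_ : x <= 1)//; lra.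
Qed.

Lemma law01_itv P F c d : law01 P F -> 0 < c -> c <= d -> d < 1 ->
  pr P `]c, d] = F d - F c.
Proof.
case=> FP _ _ _ c0 cd d1.
rewrite -!FP; try by apply/andP; split; lra.
rewrite (_ : `]-oo, d]%classic = `]-oo, c] `|` `]c, d]).
  by rewrite pr_setU//; [lra|apply/disj_set2P/seteqP; split => // x /= [];
    rewrite !in_itv/= => xc /andP[cx _]; lra].
apply/seteqP; split => x /=; rewrite !in_itv/=.
  by move=> xd; have [xc|xc] := leP x c; [left|right].
by case=> [xc|/andP[]//]; lra.
Qed.

Lemma pr_unit_cube P F n : law01 P F ->
  pr (product_power P n) (~` @unit_cube R n) = 0.
Proof.
move=> PF; apply/eqP; rewrite eq_le pr_ge0 andbT.
have -> : ~` @unit_cube R n =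
    [set x : n.-tuple (measurableTypeR R) | exists i, (~` `]0%R, 1%R[) (tnth x i)].
  apply/seteqP; split => x /=.
    by move=> /existsNP[i xi]; exists i; rewrite in_itv.
  by move=> [i xi] h; apply: xi; rewrite in_itv/=; exact: h.
apply: (le_trans (pr_exists_coord _ _ _)); first exact: measurableC.
by rewrite (law01_null PF) mulr0.
Qed.

(** Inclusions of events need only be checked on the open unit cube, where
    [Sstat] dominates the weighted deviations. *)
Lemma le_pr_cube P F n (A B : set (n.-tuple (measurableTypeR R))) : law01 P F ->
  measurable A -> measurable B -> A `&` @unit_cube R n `<=` B ->
  pr (product_power P n) A <= pr (product_power P n) B.
Proof.
move=> PF mA mB AB; have mC := @measurable_unit_cube R n.
rewrite -[leRHS]addr0 -(pr_unit_cube n PF).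
have mCC : measurable (~` @unit_cube R n : set (n.-tuple (measurableTypeR R))).
  exact: measurableC.
apply: le_trans (le_pr_setU (product_power P n) mB mCC).
apply: le_pr => //; first exact: measurableU.
by move=> x Ax; have [Cx|Cx] := pselect (@unit_cube R n x); [left; exact: AB|right].
Qed.

Section fixed_size.
Context (n : nat) (n0 : (0 < n)%N).

Let n0' : 0 < n%:R :> R. Proof. by rewrite ltr0n. Qed.
Let sn : 0 < Num.sqrt n%:R :> R. Proof. by rewrite sqrtr_gt0. Qed.

(** The equation [c - t = u * wt t] has at most one root in [t]. *)
Lemma weighted_root_null P F c u : law01 P F -> 0 <= c <= 1 ->
  exists D : set (measurableTypeR R), [/\ measurable D, pr P D = 0 &
    forall t, 0 < t < 1 -> c - t = u * wt t -> D t].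
Proof.
move=> PF c01.
have [[t [t01 ht]]|h] := pselect (exists t, 0 < t < 1 /\ c - t = u * wt t).
  exists [set t]; split; [exact: measurable_set1|exact: law01_atom PF t01|].
  move=> s s01 hs; have /andP[t0 t1] := t01; have /andP[s0 s1] := s01.
  have [st|st|//] := ltgtP s t.
    by have := weighted_dev_decr c01 s0 st t1; rewrite hs ht mulrAC ltxx.
  by have := weighted_dev_decr c01 t0 st s1; rewrite hs ht mulrAC ltxx.
exists set0; split; [exact: measurable0|exact: pr_set0|].
by move=> t t01 ht; case: h; exists t.
Qed.

(** The value [u] is taken only if some observation solves one of finitely
    many equations, each with at most one root. *)
Lemma Sstat_atomless P F u : law01 P F -> 0 < u ->
  measurable ([set x | Sstat x = u] : set (n.-tuple (measurableTypeR R))) ->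
  pr (product_power P n) [set x | Sstat x = u] = 0.
Proof.
move=> PF u0 mS; apply/eqP; rewrite eq_le pr_ge0 andbT.
have k01 (k : 'I_n.+1) : 0 <= (k%:R / n%:R : R) <= 1.
  by rewrite divr_ge0//= ler_pdivrMr// mul1r ler_nat -ltnS.
pose v := u / Num.sqrt n%:R.
have [D hD] := choice (fun k : 'I_n.+1 => weighted_root_null v PF (k01 k)).
have [E hE] := choice (fun k : 'I_n.+1 => weighted_root_null (- v) PF (k01 k)).
pose B := \bigcup_(k in [set: 'I_n.+1]) (D k `|` E k).
have mDE k : measurable (D k `|` E k).
  by apply: measurableU; [case: (hD k)|case: (hE k)].
have mB : measurable B by apply: fin_bigcup_measurable.
have B0 : pr P B = 0.
  apply/eqP; rewrite eq_le pr_ge0 andbT -(mulr0 (n.+1%:R : R)).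
  apply: le_pr_bigcup_ord => // k; have [mD D0 _] := hD k; have [mE E0 _] := hE k.
  by rewrite (le_trans (le_pr_setU _ mD mE))// D0 E0 addr0.
rewrite -[leRHS](mulr0 (n%:R : R)) -B0; apply: le_trans (pr_exists_coord P n mB).
apply: (le_pr_cube PF) => //; first exact: measurable_exists_coord.
move=> x [/= Sx x01]; have [i [k h]] := Sstat_attained n0 x01 u0 Sx.
exists i, k => //.
have mv w : Num.sqrt n%:R * (k%:R / n%:R - tnth x i) = w * wt (tnth x i) ->
    k%:R / n%:R - tnth x i = w / Num.sqrt n%:R * wt (tnth x i).
  by move=> hw; apply: (mulfI (lt0r_neq0 sn)); rewrite hw; field; rewrite gt_eqF.
case: h => /mv h; [left|right].
- by have [_ _] := hD k; apply.
- by have [_ _] := hE k; apply => //; rewrite h mulNr.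
Qed.

(** By [Sstat_perturb] a small box around [x] is contained in the event, and
    boxes in the cube have positive uniform probability. *)
Lemma Sstat_no_gap (x : n.-tuple R) s u : unit_cube x -> s < Sstat x < u ->
  measurable ([set y | s < Sstat y < u] : set (n.-tuple (measurableTypeR R))) ->
  0 < pr (product_power (@unif01 R) n) [set y | s < Sstat y < u].
Proof.
move=> x01 /andP[sS Su] mG.
have [d0 /andP[d00 d02] xd0] := inside_open x01.
pose d := d0 / 2.
have d2 : 0 < d <= 2^-1 by apply/andP; split; rewrite /d; lra.
have /andP[dp _] := d2.
have S0 := Sstat_ge0 x.
have sd : 0 < Num.sqrt (d / 2) by rewrite sqrtr_gt0; lra.
pose C := (Sstat x + `|s| + Num.sqrt n%:R) / Num.sqrt (d / 2).
have C0 : 0 < C by rewrite divr_gt0// ltr_wpDl// addr_ge0.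
pose g := Num.min (Sstat x - s) (u - Sstat x).
have g0 : 0 < g by rewrite lt_min !subr_gt0 sS.
pose e := Num.min (d / 2) ((g / (2 * C)) ^+ 2).
have e0 : 0 < e.
  rewrite lt_min; apply/andP; split; first by lra.
  by rewrite exprn_gt0// divr_gt0// mulr_gt0.
have [ed eg] : e <= d / 2 /\ e <= (g / (2 * C)) ^+ 2.
  by rewrite /e !ge_min !lexx !orbT.
have reC : C * Num.sqrt e < g.
  have : Num.sqrt e <= g / (2 * C).
    have gC : 0 <= g / (2 * C) by rewrite ltW// divr_gt0// mulr_gt0.
    by rewrite -ler_sqr ?nnegrE ?sqrtr_ge0// sqr_sqrtr// ltW.
  have C2 : 0 < 2 * C by lra.
  by rewrite ler_pdivlMr// => h; lra.
have xd : inside d x.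
  by move=> i; have := xd0 i; rewrite /d => /andP[? ?]; apply/andP; split; lra.
pose A (i : 'I_n) : set (measurableTypeR R) := `]tnth x i - e, tnth x i + e]%classic.
have mA i : measurable (A i) by exact: measurable_itv.
apply: (@lt_le_trans _ _ (pr (product_power (@unif01 R) n) (box A))).
  rewrite pr_box//; apply: prodr_gt0 => i _; have := xd0 i => /andP[? ?].
  have di : d = d0 / 2 by [].
  by rewrite (law01_itv law01_unif); lra.
apply: le_pr => //; first exact: measurable_box.
move=> y hy.
have yxe i : `|tnth x i - tnth y i| <= e.
  have := hy i; rewrite /A/= in_itv/= => /andP[? ?].
  by rewrite ler_norml; apply/andP; split; lra.
have yd : inside d y.
  move=> i; have := yxe i; have := xd0 i => /andP[? ?]; rewrite ler_norml => /andP[? ?].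
  have di : d = d0 / 2 by []; apply/andP; split; lra.
have ed' : 0 <= e < d by apply/andP; split; lra.
have gs : g <= Sstat x - s by rewrite ge_min lexx.
have gu : g <= u - Sstat x by rewrite ge_min lexx orbT.
have sn0 := normr_ge0 s; have sns := ler_norm s.
have key w : w <= Sstat x + `|s| ->
    (w + Num.sqrt n%:R) * Num.sqrt e / Num.sqrt (d / 2) < g.
  move=> h; apply: le_lt_trans reC; rewrite mulrAC ler_wpM2r ?sqrtr_ge0//.
  by rewrite ler_wpM2r ?invr_ge0 ?sqrtr_ge0// lerD2r.
rewrite /=; apply/andP; split.
- rewrite ltNge; apply/negP => Sys.
  have yxe' i : `|tnth y i - tnth x i| <= e by rewrite distrC.
  have := Sstat_perturb n0 d2 ed' yd xd yxe'.
  have : Sstat y <= Sstat x + `|s| by lra.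
  by move=> /key; lra.
- have := Sstat_perturb n0 d2 ed' xd yd yxe.
  have : Sstat x <= Sstat x + `|s| by lra.
  by move=> /key; lra.
Qed.

(** [sqrt n * wt (k / n)] is the standard deviation of [n * edf x (k / n)] under
    the uniform law. The end point [k = 0] has to be excluded because its
    standard deviation is [0]. *)
Definition grid_bad r : set (n.-tuple (measurableTypeR R)) :=
  \bigcup_(k in [set: 'I_n]) [set x | (0 < k)%N /\
    r * (Num.sqrt n%:R * wt (k%:R / n%:R)) <=
    n%:R * `|edf x (k%:R / n%:R) - k%:R / n%:R| ].

Let grid_bad1 r (k : 'I_n) :
  measurable ([set x | (0 < k)%N /\
    r * (Num.sqrt n%:R * wt (k%:R / n%:R)) <=
    n%:R * `|edf x (k%:R / n%:R) - k%:R / n%:R| ] : set (n.-tuple (measurableTypeR R))).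
Proof.
have [k0|k0] := posnP k.
  by rewrite (_ : [set _ | _] = set0)//; apply/seteqP; split => // x [].
rewrite (_ : [set _ | _] = [set x : n.-tuple (measurableTypeR R) |
    r * (Num.sqrt n%:R * wt (k%:R / n%:R)) / n%:R <=
    `|edf x (k%:R / n%:R) - k%:R / n%:R| ]); first exact: measurable_edf_dev.
apply/seteqP; split => x /=; rewrite ler_pdivrMr// [_ * n%:R]mulrC//.
by case.
Qed.

Lemma measurable_grid_bad r : measurable (grid_bad r).
Proof. by apply: fin_bigcup_measurable => // k _; exact: grid_bad1. Qed.

(** At an interior grid point the standard deviation is at least
    [sqrt (1 / 2)], within the range of [edf_tail]. *)
Lemma pr_grid_bad r :
  pr (product_power (@unif01 R) n) (grid_bad r) <= n%:R * (4 * expR (- (r / 4))).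
Proof.
apply: le_pr_bigcup_ord => [k|k]; first exact: grid_bad1.
have e0 : 0 <= 4 * expR (- (r / 4)) by rewrite mulr_ge0 ?expR_ge0.
have [k0|k0] := posnP k.
  by rewrite (_ : [set _ | _] = set0) ?pr_set0//; apply/seteqP; split => // x [].
have kn1 : 1 <= k%:R :> R by rewrite ler1n.
have kn2 : k%:R + 1 <= n%:R :> R by rewrite natr1 ler_nat.
have p01 : 0 < (k%:R / n%:R : R) < 1.
  by rewrite divr_gt0 ?ltr0n//= ltr_pdivrMr// mul1r ltr_nat.
have pE : pr (@unif01 R) `]-oo, k%:R / n%:R] = k%:R / n%:R.
  by case: law01_unif => h _ _ _; exact: h.
set p : R := k%:R / n%:R in p01 pE *.
have /andP[p0 p1] := p01.
have v2 : (Num.sqrt n%:R * wt p) ^+ 2 = n%:R * (p * (1 - p)).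
  by rewrite exprMn sqr_sqrtr ?ler0n// sqr_wt// !ltW.
have npE : n%:R * p = k%:R by rewrite /p mulrC divfK// gt_eqF.
have v : 2^-1 <= Num.sqrt n%:R * wt p.
  rewrite -ler_sqr ?nnegrE ?mulr_ge0 ?wt_ge0 ?sqrtr_ge0// v2.
  rewrite mulrA npE; have [h|h] := leP p 2^-1; first by nra.
  have : n%:R * (1 - p) >= 1 by rewrite mulrBr npE; lra.
  have : k%:R * (1 - p) = p * (n%:R * (1 - p)) by rewrite -npE; ring.
  by move=> ->; nra.
have := @edf_tail R (@unif01 R) n p r (Num.sqrt n%:R * wt p) n0 v.
rewrite pE v2 lexx => /(_ isT); apply: le_trans.
have := grid_bad1 r k; rewrite k0 => mB; apply: (le_pr _ mB).
  rewrite (_ : [set _ | _] = [set x : n.-tuple (measurableTypeR R) |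
    r * (Num.sqrt n%:R * wt p) / n%:R <= `|edf x p - p| ]);
    first exact: measurable_edf_dev.
  by apply/seteqP; split => x /=; rewrite ler_pdivrMr// [_ * n%:R]mulrC.
by move=> x [].
Qed.

Lemma edf_dev_good x r t : unit_cube x -> 0 <= r -> ~ grid_bad r x -> 0 < t < 1 ->
  n%:R * `|edf x t - t| <= r * Num.sqrt n%:R * wt t + r + 1.
Proof.
move=> x01 r0 hx; apply: edf_dev_grid => // k k0.
by rewrite leNgt; apply/negP => /ltW h; apply: hx; exists k.
Qed.

Lemma Kstat_null_tail r : 0 <= r ->
  pr (product_power (@unif01 R) n) [set x | 2 * (r + 1) < Kstat x] <=
  n%:R * (4 * expR (- (r / 4))).
Proof.
move=> r0; apply: le_trans (pr_grid_bad r).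
apply: (le_pr_cube law01_unif); [exact: measurable_Kstat_gt|
  exact: measurable_grid_bad|].
move=> x [/= Kx x01]; apply: contrapT => hx.
move: Kx; apply/negP; rewrite -leNgt; apply: Kstat_le => // t t01.
rewrite -(ler_pM2l sn) mulrA -expr2 sqr_sqrtr ?ler0n//.
apply: (le_trans (edf_dev_good x01 r0 hx t01)).
have s1 : 1 <= Num.sqrt n%:R :> R by rewrite -[leLHS]sqrtr1 ler_wsqrtr// ler1n.
have : wt t <= 2^-1 by apply: wt_le; case/andP: t01 => *; apply/andP; split; exact: ltW.
move=> w2; have : r * Num.sqrt n%:R * wt t <= r * Num.sqrt n%:R.
  by rewrite ler_piMr//; [rewrite mulr_ge0// ltW|lra].
nra.
Qed.

(** The first and last observations are the only source of a polynomial
    tail: they are within [1 / (2 n r)] of the end points with probability of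
    order [1 / r]. *)
Lemma Sstat_null_tail r : (1 < n)%N -> 1 <= r ->
  pr (product_power (@unif01 R) n) [set x | 3 * (r + 1) ^+ 2 < Sstat x] <=
  r^-1 + n%:R * (4 * expR (- (r / 4))).
Proof.
move=> n1 r1; have r0 : 0 < r by lra.
have n2 : 2 <= n%:R :> R by rewrite ler_nat.
pose d := (2 * n%:R * r)^-1.
have nr : 2 <= n%:R * r by nra.
have dE : n%:R * (2 * d) = r^-1 by rewrite /d; field; rewrite !gt_eqF.
have d0 : 0 < d by rewrite invr_gt0 !mulr_gt0.
have d2 : d < 2^-1 by rewrite ltf_pV2 ?posrE ?mulr_gt0//; lra.
pose A := [set x : n.-tuple (measurableTypeR R) | exists i, (~` `[d, 1 - d]) (tnth x i)].
have mA : measurable A by apply: measurable_exists_coord; exact: measurableC.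
have Ar : pr (product_power (@unif01 R) n) A <= r^-1.
  apply: (le_trans (pr_exists_coord _ _ _)); first exact: measurableC.
  have := law01_compl law01_unif (d := d); rewrite d0 d2 => /(_ isT) h.
  by rewrite -dE ler_pM2l//; lra.
apply: le_trans (lerD Ar (pr_grid_bad r)).
apply: le_trans (le_pr_setU _ mA (measurable_grid_bad r)).
apply: (le_pr_cube law01_unif); [exact: measurable_Sstat_gt|
  by apply: measurableU => //; exact: measurable_grid_bad|].
move=> x [/= Sx x01]; apply: contrapT => /not_orP[hA hx].
have xd : inside d x.
  move=> i; apply/negP => /negP h; apply: hA; exists i => /=.
  by rewrite in_itv/=; exact/negP.
have d2' : 0 < d <= 2^-1 by rewrite d0 ltW.
move: Sx; apply/negP; rewrite -leNgt; apply: Sstat_le => // t t01.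
have w0 := wt_gt0 t01.
set q := Num.sqrt r.
have q0 : 0 < q by rewrite sqrtr_gt0.
have qq : q ^+ 2 = r by rewrite sqr_sqrtr// ltW.
have q1 : 1 <= q by rewrite -[leLHS]sqrtr1 ler_wsqrtr.
have qr : q <= r by rewrite -qq expr2 ler_peMr// ltW.
have [tin|tout] := boolP (d <= t <= 1 - d); last first.
  have := edf_dev_outside n0 d2' xd t01 tout; rewrite -(ler_pM2l sn) => h.
  apply: (le_trans h); rewrite mulrA -sqrtrM ?ler0n// dE.
  rewrite ler_pM2r//; apply: (@le_trans _ _ 1); last by nra.
  by rewrite -sqrtr1 ler_wsqrtr// invf_le1.
have hw : 1 <= 2 * q * (Num.sqrt n%:R * wt t).
  have : (2 * q)^-1 <= Num.sqrt n%:R * wt t.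
    apply: le_trans (ler_wpM2l (ltW sn) (wt_ge d2' tin)).
    rewrite -sqrtrM ?ler0n// (_ : n%:R * _ = ((2 * q)^-1) ^+ 2).
      by rewrite sqrtr_sqr ler_norm.
    have -> : n%:R * (d / 2) = n%:R * (2 * d) / 4 by field.
    by rewrite dE -qq; field; rewrite gt_eqF.
  by rewrite invf_ple ?posrE ?mulr_gt0// => h; rewrite -(ler_pdivrMr _ _ (mulr_gt0 sn w0)) mul1r.
rewrite -(ler_pM2l sn) mulrA -expr2 sqr_sqrtr ?ler0n//.
apply: (le_trans (edf_dev_good x01 (ltW r0) hx t01)).
set W := Num.sqrt n%:R * wt t in hw *.
have W0 : 0 < W by rewrite mulr_gt0.
have -> : r * Num.sqrt n%:R * wt t + r + 1 = r * W + (r + 1) * 1 by rewrite /W; ring.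
have -> : Num.sqrt n%:R * (3 * (r + 1) ^+ 2 * wt t) = 3 * (r + 1) ^+ 2 * W.
  by rewrite /W; ring.
apply: (@le_trans _ _ (r * W + (r + 1) * (2 * q * W))).
  by rewrite lerD2l ler_wpM2l//; lra.
have : q * W <= r * W by rewrite ler_pM2r.
nra.
Qed.

(** If no observation is within [d] of an end point, then the statistic is
    bounded by [Sstat_le_inside]. *)
Lemma Sstat_tail P F d : law01 P F -> 0 < d < 2^-1 ->
  pr (product_power P n) [set x | Num.sqrt n%:R * (2 / Num.sqrt d) < Sstat x] <=
  n%:R * (F d + (1 - F (1 - d))).
Proof.
move=> PF d2.
have mC : measurable (~` `[d, 1 - d]%classic : set (measurableTypeR R)).
  exact: measurableC.
apply: le_trans (ler_wpM2l (ler0n _ _) (law01_compl PF d2)).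
apply: le_trans (pr_exists_coord P n mC).
apply: le_pr; [exact: measurable_Sstat_gt|exact: measurable_exists_coord|].
move=> x /= Sx; apply: contrapT => hA; move: Sx; apply/negP; rewrite -leNgt.
apply: Sstat_le_inside => //; first by case/andP: d2 => *; apply/andP; split; lra.
move=> i; apply/negP => /negP h; apply: hA; exists i => /=.
by rewrite in_itv/=; exact/negP.
Qed.

(** A single observation below [c] makes [edf x t - t] at least
    [1 / (2 n)] at a point where the weight is at most [sqrt c]. *)
Lemma Sstat_null_lower c u : 0 <= u -> 0 < c -> c * (2 * n%:R) <= 1 ->
  4 * n%:R * u ^+ 2 * c < 1 -> c < 1 ->
  c <= pr (product_power (@unif01 R) n) [set x | u < Sstat x].
Proof.
move=> u0 c0 c1 c2 c3; pose i0 := Ordinal n0.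
have -> : c = pr (product_power (@unif01 R) n) [set x | `]-oo, c]%classic (tnth x i0)].
  by rewrite pr_coord//; case: law01_unif => -> //; rewrite c0.
apply: (le_pr_cube law01_unif); [exact: measurable_coord|exact: measurable_Sstat_gt|].
move=> x [/=]; rewrite in_itv/= => xc x01; have := x01 i0; set t := tnth x i0 in xc *.
move=> t01; have /andP[t0 t1] := t01.
have w0 := wt_gt0 t01; rewrite -(ltr_pM2r w0).
apply: lt_le_trans (Sstat_ge n0 x01 t01).
have e1 : n%:R^-1 <= edf x t.
  by rewrite /edf (bigD1 i0)//= lexx mulrDl mul1r lerDl divr_ge0// sumr_ge0.
have nV : n%:R * n%:R^-1 = 1 :> R by rewrite mulfV// gt_eqF.
have tn : t <= (2 * n%:R)^-1.
  by rewrite (le_trans xc)// -[leRHS]mul1r ler_pdivlMr// mulr_gt0.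
have e2 : (2 * n%:R)^-1 <= `|edf x t - t|.
  apply: le_trans (ler_norm _); have : (2 * n%:R)^-1 = n%:R^-1 / 2 :> R.
    by field; rewrite gt_eqF.
  by lra.
apply: (@lt_le_trans _ _ (Num.sqrt n%:R * (2 * n%:R)^-1)); last by rewrite ler_pM2l.
have i0' : 0 < (2 * n%:R)^-1 :> R by rewrite invr_gt0 mulr_gt0.
rewrite -ltr_sqr ?nnegrE ?mulr_ge0 ?(ltW w0)//.
rewrite !exprMn sqr_wt; last by rewrite !ltW.
rewrite sqr_sqrtr ?ler0n//.
have -> : n%:R * (2 * n%:R)^-1 ^+ 2 = (4 * n%:R)^-1 :> R by field; rewrite gt_eqF.
rewrite -[ltRHS]mul1r ltr_pdivlMr ?mulr_gt0//.
apply: le_lt_trans c2; have : t * (1 - t) <= c by nra.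
move=> h; have := ler_wpM2l (sqr_ge0 u) h; nra.
Qed.

(** Triangle inequality at the single point [t]: [edf x t] is within
    [r / sqrt n] of [F t]. *)
Lemma Kstat_alt P F t r u : law01 P F -> 0 < t < 1 ->
  u < Num.sqrt n%:R * `|F t - t| - r ->
  1 - 4 * expR (- (r / 4)) <= pr (product_power P n) [set x | u < Kstat x].
Proof.
move=> PF t01 hu; have mK := @measurable_Kstat_gt R n n0 u.
rewrite lerBlDr -lerBlDl -pr_setC//.
have Ft : pr P `]-oo, t] = F t by case: PF => h _ _ _; exact: h.
have s1 : 1 <= Num.sqrt n%:R :> R by rewrite -[leLHS]sqrtr1 ler_wsqrtr// ler1n.
have := @edf_tail R P n t r (Num.sqrt n%:R) n0; rewrite Ft sqr_sqrtr ?ler0n//.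
have p0 : 0 <= F t by rewrite -Ft pr_ge0.
have p1 : F t <= 1 by rewrite -Ft pr_le1.
move=> h; apply: le_trans (h _ _); [|by lra|by rewrite ler_piMr//; nra].
apply: le_pr; first exact: measurableC.
  rewrite (_ : [set _ | _] = [set x : n.-tuple (measurableTypeR R) |
    r * Num.sqrt n%:R / n%:R <= `|edf x t - F t| ]);
    first exact: measurable_edf_dev.
  by apply/seteqP; split => x /=; rewrite ler_pdivrMr// [_ * n%:R]mulrC.
move=> x /= /negP; rewrite -leNgt => Kx.
have snn : n%:R = Num.sqrt n%:R * Num.sqrt n%:R :> R by rewrite -expr2 sqr_sqrtr ?ler0n.
rewrite [leRHS](_ : _ = `|edf x t - F t| * Num.sqrt n%:R * Num.sqrt n%:R).
  rewrite ler_pM2r// mulrC.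
  have := Kstat_ge n0 x t01.
  have : `|F t - t| <= `|edf x t - F t| + `|edf x t - t|.
    rewrite (_ : F t - t = (F t - edf x t) + (edf x t - t)); last by ring.
    by rewrite (le_trans (ler_normD _ _))// distrC.
  by move=> /(ler_wpM2l (ltW sn)); rewrite mulrDr; lra.
by rewrite -mulrA -snn mulrC.
Qed.

(** The weight is at most [1 / 2]. *)
Lemma pr_Kstat_le_Sstat P F u : law01 P F -> 0 <= u ->
  pr (product_power P n) [set x | u < Kstat x] <=
  pr (product_power P n) [set x | u < Sstat x].
Proof.
move=> PF u0; apply: (le_pr_cube PF);
  [exact: measurable_Kstat_gt|exact: measurable_Sstat_gt|].
move=> x [/= Kx x01]; apply: (lt_le_trans Kx); apply: Kstat_le => // t t01.
apply: (le_trans (Sstat_ge n0 x01 t01)); rewrite ler_piMr ?Sstat_ge0//.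
apply: (@le_trans _ _ 2^-1); last by lra.
by apply: wt_le; case/andP: t01 => *; apply/andP; split; exact: ltW.
Qed.

End fixed_size.
End laws.


(** * Quantiles and critical values *)

Section quantile.
Context d (T : measurableType d) (R : realType) (mu : probability T R).

Lemma pr_bigcup_le (E : (set T)^nat) (c : R) :
  (forall k, measurable (E k)) -> nondecreasing_seq E ->
  (forall k, pr mu (E k) <= c) -> pr mu (\bigcup_k E k) <= c.
Proof.
move=> mE ndE Ec; have mU := bigcupT_measurable E mE.
rewrite -lee_fin -prE//.
apply: (cvge_to_le (nondecreasing_cvg_mu mE mU ndE)).
by apply: nearW => k /=; rewrite prE// lee_fin.
Qed.

Context (f : T -> R) (a : R)
  (mf : forall u, measurable [set x | u < f x])
  (f0 : forall x, 0 <= f x)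
  (a01 : 0 < a < 1).

Definition upper_levels := [set u | pr mu [set x | u < f x] <= a].

Lemma upper_levels_lb : lbound upper_levels 0.
Proof.
move=> u /= ua; rewrite leNgt; apply/negP => u0; move: ua; apply/negP.
rewrite -ltNge (_ : [set _ | _] = setT) ?pr_setT; first by case/andP: a01.
by apply/seteqP; split => // x _ /=; exact: lt_le_trans (f0 x).
Qed.

Lemma upper_levels_has_lb : has_lbound upper_levels.
Proof. by exists 0; exact: upper_levels_lb. Qed.

(** Otherwise all the events [f <= k] have probability at most [1 - a], and
    so does their union, which is the whole space. *)
Lemma upper_levels_nonempty : upper_levels !=set0.
Proof.
apply: contrapT => /set0P/negP/negPn/eqP h.
pose E (k : nat) := ~` [set x | k%:R < f x].
have mE k : measurable (E k) by exact: measurableC.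
have : pr mu (\bigcup_k E k) <= 1 - a.
  apply: pr_bigcup_le => // [k l kl|k].
    apply/subsetPset => x; rewrite /E /= => /negP; rewrite -leNgt => fk.
    by apply/negP; rewrite -leNgt (le_trans fk)// ler_nat.
  rewrite pr_setC// lerD2l lerN2; apply: contrapT => /negP; rewrite -ltNge => /ltW ka.
  by have : upper_levels k%:R by []; rewrite h.
rewrite (_ : \bigcup_k _ = setT) ?pr_setT; first by case/andP: a01; lra.
apply/seteqP; split => // x _; exists (Num.truncn (f x)).+1 => //.
by rewrite /E /=; apply/negP; rewrite -leNgt ltW// truncnS_gt.
Qed.

Definition quantile := inf upper_levels.

Lemma quantile_ge0 : 0 <= quantile.
Proof. by apply: lb_le_inf; [exact: upper_levels_nonempty|exact: upper_levels_lb]. Qed.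

Lemma quantile_le u : pr mu [set x | u < f x] <= a -> quantile <= u.
Proof. by move=> ua; apply: ge_inf => //; exact: upper_levels_has_lb. Qed.

Lemma quantile_gt u : a < pr mu [set x | u < f x] -> u <= quantile.
Proof.
move=> ua; apply: lb_le_inf; first exact: upper_levels_nonempty.
move=> v /= va; rewrite leNgt; apply/negP => vu; move: ua; apply/negP.
rewrite -leNgt; apply: le_trans va; apply: le_pr => // x /=; exact: lt_trans.
Qed.

Lemma quantile_lt u : quantile < u -> pr mu [set x | u < f x] <= a.
Proof.
move=> qu; have [v /= va vu] := inf_lt upper_levels_nonempty qu.
apply: le_trans va; apply: le_pr => // x /=; exact: lt_trans.
Qed.

Lemma pr_quantile_le : pr mu [set x | quantile < f x] <= a.
Proof.
rewrite (_ : [set _ | _] = \bigcup_k [set x | quantile + k.+1%:R^-1 < f x]).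
  apply: pr_bigcup_le => // [k l kl|k].
    apply/subsetPset => x /=; apply: le_lt_trans.
    by rewrite lerD2l lef_pV2 ?posrE// ler_nat ltnS.
  by apply: quantile_lt; rewrite ltrDl invr_gt0.
apply/seteqP; split => x /=.
  rewrite -subr_gt0 => h; exists (Num.truncn (f x - quantile)^-1) => //=.
  rewrite -ltrBrDl -[ltRHS]invrK ltf_pV2 ?posrE ?invr_gt0//.
  exact: truncnS_gt.
by move=> [k _ /=]; apply: le_lt_trans; rewrite lerDl.
Qed.

Lemma pr_quantile_ge : a <= pr mu [set x | quantile <= f x].
Proof.
have mlt : measurable [set x | f x < quantile] /\
    pr mu [set x | f x < quantile] <= 1 - a.
  have -> : [set x | f x < quantile] =
      \bigcup_k ~` [set x | quantile - k.+1%:R^-1 < f x].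
    apply/seteqP; split => x /=.
      rewrite -subr_gt0 => h; exists (Num.truncn (quantile - f x)^-1) => //=.
      apply/negP; rewrite -leNgt lerBrDr -lerBrDl.
      rewrite -[leRHS]invrK lef_pV2 ?posrE ?invr_gt0// ltW//.
      exact: truncnS_gt.
    move=> [k _ /= /negP]; rewrite -leNgt => h; apply: (le_lt_trans h).
    by rewrite ltrBlDr ltrDl.
  split; first by apply: bigcupT_measurable => k; exact: measurableC.
  apply: pr_bigcup_le => // [k|k l kl|k]; first exact: measurableC.
    apply/subsetPset => x; apply: contra_not => /=; apply: le_lt_trans.
    by rewrite lerD2l lerN2 lef_pV2 ?posrE// ler_nat ltnS.
  rewrite pr_setC// lerD2l lerN2 leNgt; apply/negP => /ltW/quantile_le.
  by rewrite leNgt ltrBlDr ltrDl invr_gt0 ltr0n.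
have -> : [set x | quantile <= f x] = ~` [set x | f x < quantile].
  by apply/seteqP; split => x /=; [move=> h; apply/negP; rewrite -leNgt|
    move=> /negP; rewrite -leNgt].
by case: mlt => m h; rewrite pr_setC//; lra.
Qed.

End quantile.

(** * The logarithmic transform of the weighted statistic *)

Section Mstat_transform.
Context {R : realType}.

(** [Mstat] is [sqrtln1] applied to [Sstat]; this map is a strictly increasing
    bijection of the nonnegative reals, so that events transfer between the
    two statistics. *)
Definition sqrtln1 (y : R) : R := Num.sqrt (ln (y + 1)).

Lemma sqrtln1_lt y z : 0 <= y -> 0 <= z -> (sqrtln1 y < sqrtln1 z) = (y < z).
Proof.
move=> y0 z0.
have ly : 0 <= ln (y + 1) by apply: ln_ge0; lra.
have lz : 0 <= ln (z + 1) by apply: ln_ge0; lra.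
rewrite -ltr_sqr ?nnegrE ?sqrtr_ge0// !sqr_sqrtr//.
by rewrite ltr_ln ?posrE ?ltrD2r//; lra.
Qed.

Lemma sqrtln1_surj u : 0 <= u -> exists2 y, 0 <= y & u = sqrtln1 y.
Proof.
move=> u0; exists (expR (u ^+ 2) - 1).
  by rewrite subr_ge0 -expR0 ler_expR sqr_ge0.
by rewrite /sqrtln1 subrK expRK sqrtr_sqr ger0_norm.
Qed.

Context (n : nat) (n0 : (0 < n)%N).

Lemma Mstat_gtE y : 0 <= y ->
  [set x : n.-tuple R | sqrtln1 y < Mstat x] = [set x | y < Sstat x].
Proof.
by move=> y0; apply/seteqP; split => x /=; rewrite sqrtln1_lt// Sstat_ge0.
Qed.

Lemma measurable_Mstat_gt u :
  measurable ([set x | u < Mstat x] : set (n.-tuple (measurableTypeR R))).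
Proof.
have [/sqrtln1_surj[y y0 ->]|u0] := leP 0 u.
  by rewrite Mstat_gtE//; exact: measurable_Sstat_gt.
rewrite (_ : [set _ | _] = setT)//; apply/seteqP; split => // x _ /=.
exact: lt_le_trans (sqrtr_ge0 _).
Qed.

Implicit Type P : probability (measurableTypeR R) R.

Lemma critical_value_M a : critical_value (@Mstat R) a n =
  quantile (product_power (@unif01 R) n) (@Mstat R n) a.
Proof.
congr inf; apply/seteqP; split => u /=; rewrite /exceed_prob prE ?lee_fin//;
  exact: measurable_Mstat_gt.
Qed.

Lemma critical_value_K a : critical_value (@Kstat R) a n =
  quantile (product_power (@unif01 R) n) (@Kstat R n) a.
Proof.
congr inf; apply/seteqP; split => u /=; rewrite /exceed_prob prE ?lee_fin//;
  exact: measurable_Kstat_gt.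
Qed.

Lemma power_ME P a : power P (@Mstat R) a n = (pr (product_power P n)
  [set x | critical_value (@Mstat R) a n < Mstat x])%:E.
Proof. by rewrite /power /exceed_prob prE//; exact: measurable_Mstat_gt. Qed.

Lemma power_KE P a : power P (@Kstat R) a n = (pr (product_power P n)
  [set x | critical_value (@Kstat R) a n < Kstat x])%:E.
Proof. by rewrite /power /exceed_prob prE//; exact: measurable_Kstat_gt. Qed.

Lemma measurable_Mstat_ge u :
  measurable ([set x | u <= Mstat x] : set (n.-tuple (measurableTypeR R))).
Proof.
rewrite (_ : [set _ | _] = \bigcap_k [set x | u - k.+1%:R^-1 < Mstat x]).
  by apply: bigcapT_measurable => k; exact: measurable_Mstat_gt.
apply/seteqP; split => x /= h.
  by move=> k _ /=; apply: lt_le_trans h; rewrite ltrBlDr ltrDl invr_gt0.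
rewrite leNgt; apply/negP; rewrite -subr_gt0 => hu.
have := h (Num.truncn (u - Mstat x)^-1) I; rewrite /=; apply/negP.
rewrite -leNgt lerBrDr -lerBrDl -[leRHS]invrK lef_pV2 ?posrE ?invr_gt0// ltW//.
exact: truncnS_gt.
Qed.

(** The critical value [m] at level [P_0 (q < Mstat)] may be smaller than [q],
    but then [m < Mstat <= q] is null under the uniform law. By [Sstat_no_gap]
    the event [m < Mstat < q] contains no point of the open cube, and
    [Mstat = q] is null under [P] by [Sstat_atomless]. *)
Lemma power_at_level P F q a : law01 P F -> 0 < q ->
  a = pr (product_power (@unif01 R) n) [set x | q < Mstat x] -> 0 < a < 1 ->
  power P (@Mstat R) a n = (pr (product_power P n) [set x | q < Mstat x])%:E /\
  pr (product_power P n) [set x | q <= Mstat x] =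
  pr (product_power P n) [set x | q < Mstat x].
Proof.
move=> PF q0 aE a01; rewrite power_ME; set m := critical_value _ _ _.
have M0 (x : n.-tuple R) : 0 <= Mstat x by exact: sqrtr_ge0.
have mM := measurable_Mstat_gt.
have mge := measurable_Mstat_ge.
have mq : m <= q.
  by rewrite /m critical_value_M; apply: quantile_le => //; rewrite -aE.
have ma : pr (product_power (@unif01 R) n) [set x | m < Mstat x] <= a.
  rewrite /m critical_value_M; exact: pr_quantile_le.
have m0 : 0 <= m by rewrite /m critical_value_M; exact: quantile_ge0.
have [y y0 my] := sqrtln1_surj m0.
have [z z0 qz] := sqrtln1_surj (ltW q0).
have zp : 0 < z.
  rewrite lt_neqAle z0 andbT; apply/eqP => z00; move: q0.
  by rewrite qz -z00 /sqrtln1 add0r ln1 sqrtr0 ltxx.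
have mS s : measurable ([set x | s < Sstat x] : set (n.-tuple (measurableTypeR R))).
  exact: measurable_Sstat_gt.
have mle : measurable ([set x | z <= Sstat x] : set (n.-tuple (measurableTypeR R))).
  rewrite (_ : [set _ | _] = [set x | q <= Mstat x])//.
  apply/seteqP; split => x /=; rewrite qz !leNgt sqrtln1_lt ?Sstat_ge0//.
have eqE : [set x : n.-tuple (measurableTypeR R) | Sstat x = z] =
    [set x | z <= Sstat x] `&` ~` [set x | z < Sstat x].
  apply/seteqP; split => x /=; first by move=> ->; rewrite lexx ltxx; split.
  by move=> [h /negP]; rewrite -leNgt => h'; apply/eqP; rewrite eq_le h'.
have meq : measurable ([set x | Sstat x = z] : set (n.-tuple (measurableTypeR R))).
  by rewrite eqE; apply: measurableI => //; exact: measurableC.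
have eq0 := Sstat_atomless n0 PF zp meq.
have leE : pr (product_power P n) [set x | q <= Mstat x] =
    pr (product_power P n) [set x | q < Mstat x].
  apply/eqP; rewrite eq_le; apply/andP; split; last by apply: le_pr => // x /ltW.
  rewrite -[leRHS]addr0 -eq0.
  apply: le_trans (le_pr_setU (product_power P n) (mM q) meq).
  apply: le_pr => //; first exact: measurableU.
  move=> x /=; rewrite le_eqVlt => /orP[/eqP qM|]; [right|by left].
  apply/eqP; rewrite eq_le !leNgt.
  by rewrite -(sqrtln1_lt z0 (Sstat_ge0 x)) -(sqrtln1_lt (Sstat_ge0 x) z0) -qz qM ltxx.
split => //; congr (_%:E); apply/eqP; rewrite eq_le; apply/andP; split; last first.
  by apply: le_pr => // x /=; exact: le_lt_trans.
rewrite -leE; apply: (le_pr_cube PF) => //.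
move=> x [/= mx x01]; rewrite leNgt; apply/negP => xq.
have yS : y < Sstat x < z.
  rewrite -(sqrtln1_lt y0 (Sstat_ge0 x)) -(sqrtln1_lt (Sstat_ge0 x) z0) -my -qz.
  exact/andP.
pose G : set (n.-tuple (measurableTypeR R)) := [set w | y < Sstat w < z].
have mG : measurable G.
  rewrite (_ : G = [set w | y < Sstat w] `&` ~` [set w | z <= Sstat w]).
    by apply: measurableI => //; exact: measurableC.
  apply/seteqP; split => w /=; first by move=> /andP[yw wz]; split => //; apply/negP; rewrite -ltNge.
  by move=> [yw /negP]; rewrite -ltNge => wz; apply/andP.
have := Sstat_no_gap n0 x01 yS mG; rewrite ltNge => /negP; apply.
(* [G] and [q < Mstat] are disjoint, and the second has probability [a] *)
have : pr (product_power (@unif01 R) n) (G `|` [set w | q < Mstat w]) <= a.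
  apply: le_trans ma; apply: le_pr => //; first exact: measurableU.
  move=> w /= [/andP[yw _]|qw]; last exact: le_lt_trans qw.
  by rewrite my sqrtln1_lt ?Sstat_ge0.
rewrite pr_setU//; first by rewrite -aE; lra.
apply/disj_set2P/seteqP; split => // w /= [/andP[_ wz]].
by rewrite qz sqrtln1_lt ?Sstat_ge0// ltNge (ltW wz).
Qed.

End Mstat_transform.

Section limn_einf_esup.
Context {R : realType}.
Implicit Type u : (\bar R)^nat.

Lemma lt_limn_einf u c : (c < limn_einf u)%E -> \forall n \near \oo, (c < u n)%E.
Proof.
rewrite limn_einf_lim.
have /cvg_lim -> // := ereal_nondecreasing_cvgn (nondecreasing_einfs u).
move=> /ereal_sup_gt[_ [N _ <-] h]; exists N => // n /= Nn.
by apply: (lt_le_trans h); apply: ereal_inf_lbound; exists n.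
Qed.

Lemma limn_esup_lt u c : (limn_esup u < c)%E -> \forall n \near \oo, (u n < c)%E.
Proof.
rewrite -lteN2 -limn_einfN => /lt_limn_einf; apply: filterS => n.
by rewrite /= lteN2.
Qed.

End limn_einf_esup.


(** * Growth of the signal *)

Section growth.
Context {R : realType}.

Lemma near_ln_ge (c : R) : \forall n \near \oo, c <= ln (n%:R : R).
Proof.
near=> n; have h : expR c <= n%:R :> R by near: n; exact: nbhs_infty_ger.
rewrite -[leLHS]expRK ler_ln ?posrE ?expR_gt0//.
exact: lt_le_trans (expR_gt0 c) h.
Unshelve. all: by end_near. Qed.

Lemma ln_le_sqrt (n : nat) : (0 < n)%N -> ln n%:R <= 2 * Num.sqrt n%:R :> R.
Proof.
move=> n0; have s0 : 0 < Num.sqrt n%:R :> R by rewrite sqrtr_gt0 ltr0n.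
rewrite -{1}(sqr_sqrtr (ler0n R n)) lnXn// mulr2n mulrDl mul1r.
by apply: lerD; exact/ltW/ln_sublinear.
Qed.

(** The same argument gives every power of [ln n]; the cube is large enough for
    all the comparisons below. *)
Lemma near_signal (theta : nat -> R) : (forall n, 0 < theta n < 1) ->
  ln (n%:R * theta n ^+ 2) / ln (ln n%:R) @[n --> \oo] --> +oo ->
  \forall n \near \oo, ln n%:R ^+ 3 <= Num.sqrt n%:R * theta n.
Proof.
(* [ln (ln n ^ 6) = 6 * ln (ln n)], and [theta] enters squared *)
move=> th01 /cvgryPge/(_ 6) h6; near=> n.
have /andP[th0 _] := th01 n.
have n0 : 0 < n%:R :> R.
  by apply: (@lt_le_trans _ _ 1) => //; near: n; exact: nbhs_infty_ger.
have L : expR 1 <= ln (n%:R : R) by near: n; exact: near_ln_ge.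
have L0 : 0 < ln (n%:R : R) := lt_le_trans (expR_gt0 1) L.
have LL : 0 < ln (ln (n%:R : R)).
  apply: (@lt_le_trans _ _ 1) => //.
  by rewrite -[leLHS]expRK ler_ln ?posrE ?expR_gt0.
have : 6 <= ln (n%:R * theta n ^+ 2) / ln (ln n%:R) by near: n; exact: h6.
rewrite ler_pdivlMr// => h.
rewrite -ler_sqr ?nnegrE ?exprn_ge0 ?mulr_ge0 ?sqrtr_ge0 ?(ltW L0) ?(ltW th0)//.
rewrite -exprM exprMn sqr_sqrtr ?ler0n//.
have nt : 0 < n%:R * theta n ^+ 2 by rewrite mulr_gt0// exprn_gt0.
by rewrite -ler_ln ?posrE ?exprn_gt0// lnXn// -[ln _ *+ _]mulr_natl.
Unshelve. all: by end_near. Qed.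

End growth.

(** * The contamination model *)

Section model.
Context {R : realType} (A : R -> R) (theta : nat -> R)
  (P : nat -> probability (measurableTypeR R) R).

Definition Fn n t : R := t + theta n * A t.

Lemma law01_model n : {within `[0, 1], continuous A} -> A 0 = 0 -> A 1 = 0 ->
  (forall t : R, 0 < t < 1 ->
    P n `]-oo, t]%classic = (t + theta n * A t)%:E) -> law01 (P n) (Fn n).
Proof.
move=> cA A0 A1 hP; split; rewrite /Fn.
- by move=> t t01; rewrite /pr hP.
- have cid : {within `[0, 1], continuous (@id R)}.
    by apply: continuous_subspaceT => s; exact: cvg_id.
  move=> t; apply: cvgD; first exact: cid.
  by apply: cvgM; [exact: cvg_cst|exact: cA].
- by rewrite A0 mulr0 addr0.
- by rewrite A1 mulr0 addr0.
Qed.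

(** As [t * (1 - t) <= 1] and [1 / 2 <= 1 - varpi], the envelope is at most
    [Num.sqrt (t * (1 - t))]. *)
Lemma envelope_wt (varpi : R) : 0 <= varpi < 1 / 2 ->
  (ereal_sup [set (`|A t| / (t * (1 - t)) `^ (1 - varpi))%:E | t in `]0%R, 1%R[]
     < +oo)%E ->
  exists2 C, 0 <= C & forall t, 0 < t < 1 -> `|A t| <= C * wt t.
Proof.
move=> /andP[v0 v2]; set E := [set _ | _ in _] => hE.
have hpos t : 0 < t < 1 -> 0 < (t * (1 - t)) `^ (1 - varpi).
  by move=> /andP[t0 t1]; rewrite powR_gt0// mulr_gt0// subr_gt0.
have mem t : 0 < t < 1 -> E (`|A t| / (t * (1 - t)) `^ (1 - varpi))%:E.
  by move=> t01; exists t => //=; rewrite in_itv.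
have h2 : 0 < (2^-1 : R) < 1 by apply/andP; split; lra.
have s0 : (0 <= ereal_sup E)%E.
  apply: le_trans (ereal_sup_ubound (mem _ h2)).
  by rewrite lee_fin divr_ge0// ltW// hpos.
have sfin : ereal_sup E \is a fin_num by rewrite ge0_fin_numE.
exists (fine (ereal_sup E)); first exact: fine_ge0.
move=> t t01; have /andP[t0 t1] := t01.
have := ereal_sup_ubound (mem _ t01).
rewrite -(fineK sfin) lee_fin ler_pdivrMr ?hpos// => /le_trans; apply.
rewrite ler_wpM2l ?fine_ge0// /wt -powR12_sqrt; last by rewrite mulr_ge0//; lra.
have tt : 0 < t * (1 - t) <= 1 by apply/andP; split; nra.
by apply: ger_powR => //; lra.
Qed.

Context (C : R) (C0 : 0 <= C) (AC : forall t, 0 < t < 1 -> `|A t| <= C * wt t)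
  (th01 : forall n, 0 < theta n < 1)
  (PF : forall n, law01 (P n) (Fn n)).

(** At distance [d = n ^ -4] from the end points the distribution function
    deviates from [t] by at most [C * sqrt d = C / n ^ 2], so that some of the [n]
    observations is closer to them with probability [O (1 / n)]; otherwise
    [Sstat] is at most [2 * sqrt n / sqrt d]. *)
Lemma model_Sstat_tail n : (3 < n)%N ->
  pr (product_power (P n) n) [set x | n%:R ^+ 3 < Sstat x] <= (2 + 2 * C) / n%:R.
Proof.
move=> n3; have n0 : (0 < n)%N by exact: leq_trans n3.
have n4 : 4 <= n%:R :> R by rewrite ler_nat.
have np : 0 < n%:R :> R by lra.
pose d : R := (n%:R ^- 2) ^+ 2.
have nV : n%:R^-1 <= 4^-1 :> R by rewrite lef_pV2 ?posrE.
have nV0 : 0 < n%:R^-1 :> R by rewrite invr_gt0.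
have sE : n%:R ^- 2 = n%:R^-1 * n%:R^-1 :> R by rewrite -exprVn expr2.
have s0 : 0 < n%:R ^- 2 :> R by rewrite sE mulr_gt0.
have s1 : n%:R ^- 2 <= n%:R^-1 / 4 :> R by rewrite sE; nra.
have d0 : 0 < d by rewrite exprn_gt0.
have d1 : d <= n%:R ^- 2 / 4 by rewrite /d expr2; nra.
have d2 : 0 < d < 2^-1 by rewrite d0/=; lra.
have sd : Num.sqrt d = n%:R ^- 2 by rewrite sqrtr_sqr ger0_norm// ltW.
apply: (@le_trans _ _ (pr (product_power (P n) n)
    [set x | Num.sqrt n%:R * (2 / Num.sqrt d) < Sstat x])).
  apply: le_pr; [exact: measurable_Sstat_gt|exact: measurable_Sstat_gt|].
  move=> x /=; apply: le_lt_trans; rewrite sd invrK.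
  have sn : 0 < Num.sqrt n%:R :> R by rewrite sqrtr_gt0.
  have snn : Num.sqrt n%:R ^+ 2 = n%:R :> R by rewrite sqr_sqrtr ?ler0n.
  have : 2 <= Num.sqrt n%:R :> R.
    by rewrite -ler_sqr ?nnegrE ?sqrtr_ge0// snn; lra.
  move=> sn2; have : Num.sqrt n%:R * 2 <= n%:R :> R.
    by rewrite -[leRHS]snn expr2 ler_pM2l.
  by move=> h; rewrite mulrA (_ : n%:R ^+ 3 = n%:R * n%:R ^+ 2) ?exprS//
    ler_wpM2r// exprn_ge0.
apply: (le_trans (Sstat_tail n0 (PF n) d2)).
rewrite mulrC ler_pdivlMr// -mulrA.
have d01 : 0 < d < 1 by rewrite d0/=; lra.
have d01' : 0 < 1 - d < 1 by apply/andP; split; lra.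
have wd : wt d <= n%:R ^- 2.
  by rewrite -sd ler_wsqrtr// ler_piMr//; lra.
have /andP[t0 t1] := th01 n.
have a1 : theta n * A d <= C * n%:R ^- 2.
  apply: le_trans (ler_wpM2l C0 wd); apply: le_trans (AC d01).
  apply: le_trans (ler_norm _) _; rewrite normrM (gtr0_norm t0).
  by rewrite ler_piMl// ltW.
have a2 : - (theta n * A (1 - d)) <= C * n%:R ^- 2.
  apply: le_trans (ler_wpM2l C0 wd); rewrite -wtC; apply: le_trans (AC d01').
  apply: le_trans (ler_norm _) _; rewrite normrN normrM (gtr0_norm t0).
  by rewrite ler_piMl// ltW.
apply: (@le_trans _ _ ((2 + 2 * C) * n%:R ^- 2 * (n%:R * n%:R))).
  rewrite ler_pM2r ?mulr_gt0// /Fn; have : 0 <= C * n%:R ^- 2 by rewrite mulr_ge0// ltW.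
  lra.
by rewrite -mulrA -expr2 mulVf ?mulr1// sqrf_eq0 gt_eqF.
Qed.

(** The instance [c = 1 / (8 n ^ 7)] of [Sstat_null_lower] for [u = n ^ 3]. *)
Lemma null_Sstat_lower n : (1 < n)%N ->
  (8 * n%:R ^+ 7)^-1 <=
  pr (product_power (@unif01 R) n) [set x | n%:R ^+ 3 < Sstat x].
Proof.
move=> n1; have n2 : 2 <= n%:R :> R by rewrite ler_nat.
have np : 0 < n%:R :> R by lra.
have p7 : 0 < n%:R ^+ 7 :> R by rewrite exprn_gt0.
have n6 : 1 <= n%:R ^+ 6 :> R by rewrite exprn_ege1//; lra.
have n7 : 1 <= n%:R ^+ 7 :> R by rewrite exprn_ege1//; lra.
apply: Sstat_null_lower; rewrite ?exprn_ge0// ?invr_gt0 ?mulr_gt0//.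
- by apply: leq_trans n1.
- rewrite mulrC ler_pdivrMr ?mulr_gt0// mul1r exprS; nra.
- rewrite ltr_pdivrMr ?mulr_gt0// mul1r -exprM.
  by rewrite (exprS _ 6); lra.
- by rewrite invf_lt1 ?mulr_gt0//; lra.
Qed.

(** * Levels of an admissible sequence *)

(** Under the alternative [Sstat] is at most [n ^ 3] with probability tending
    to one, so that a test with non-vanishing power has a critical value below
    that of [n ^ 3], and a level at least polynomial in [1 / n]. *)
Lemma admissible_level_ge alpha : admissible (@Mstat R) P alpha ->
  \forall n \near \oo, (8 * n%:R ^+ 7)^-1 <= alpha n.
Proof.
move=> [a01 _ _ [pos _ _]].
have [c c0 hc] : exists2 c : R, 0 < c &
    \forall n \near \oo, (c%:E < power (P n) (@Mstat R) (alpha n) n)%E.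
  have hlim (c : R) : 0 < c ->
      (c%:E < limn_einf (fun n => power (P n) (@Mstat R) (alpha n) n))%E ->
      exists2 c : R, 0 < c &
      \forall n \near \oo, (c%:E < power (P n) (@Mstat R) (alpha n) n)%E.
    by move=> c0 /lt_limn_einf h; exists c.
  case E : (limn_einf _) pos => [r| |] //.
    rewrite lte_fin => r0; apply: (hlim (r / 2)); first by rewrite divr_gt0.
    by rewrite E lte_fin; lra.
  by move=> _; apply: (hlim 1) => //; rewrite E ltry.
near=> n.
have n3 : (3 < n)%N by near: n; exact: nbhs_infty_gt.
have n0 : (0 < n)%N by exact: leq_trans n3.
have np : 0 < n%:R :> R by rewrite ltr0n.
have a1 := a01 n.
have : (c%:E < power (P n) (@Mstat R) (alpha n) n)%E by near: n.
rewrite power_ME// lte_fin => hpow.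
have nc : (2 + 2 * C) / c <= n%:R by near: n; exact: nbhs_infty_ger.
have hS : pr (product_power (P n) n) [set x | n%:R ^+ 3 < Sstat x] <= c.
  apply: (le_trans (model_Sstat_tail n3)).
  by rewrite ler_pdivrMr// [c * _]mulrC -ler_pdivrMr.
have n30 : 0 <= n%:R ^+ 3 :> R by rewrite exprn_ge0.
have M0 (x : n.-tuple R) : 0 <= Mstat x by exact: sqrtr_ge0.
have crit : critical_value (@Mstat R) (alpha n) n < sqrtln1 (n%:R ^+ 3).
  rewrite ltNge; apply/negP => h; move: hpow; apply/negP; rewrite -leNgt.
  apply: le_trans hS; rewrite -Mstat_gtE//.
  apply: le_pr; [exact: measurable_Mstat_gt|exact: measurable_Mstat_gt|].
  by move=> x /=; exact: le_lt_trans.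
apply: (le_trans (null_Sstat_lower (ltnW (ltnW n3)))).
rewrite -Mstat_gtE//.
apply: (quantile_lt (measurable_Mstat_gt n0) a1).
by rewrite -critical_value_M.
Unshelve. all: by end_near. Qed.

End model.


(** * Sample sizes required by the unweighted statistic *)

Section efficiency.
Context {R : realType} (A : R -> R) (theta : nat -> R)
  (P : nat -> probability (measurableTypeR R) R) (t0 : R) (t01 : 0 < t0 < 1)
  (a0 : 0 < `|A t0|)
  (th01 : forall n, 0 < theta n < 1)
  (PF : forall n, law01 (P n) (Fn A theta n))
  (signal : \forall n \near \oo, ln n%:R ^+ 3 <= Num.sqrt n%:R * theta n).

Local Notation a := (`|A t0|).

Lemma expR_ln4 (r : R) : 0 < r -> expR (- (4 * ln r / 4)) = r^-1.
Proof.
by move=> r0; rewrite mulrAC divff// mul1r expRN lnK.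
Qed.

Lemma Kstat_alt_model n j r u : (0 < j)%N ->
  u < Num.sqrt j%:R * (theta n * a) - r ->
  1 - 4 * expR (- (r / 4)) <= pr (product_power (P n) j) [set x | u < Kstat x].
Proof.
move=> j0 hu; apply: (Kstat_alt j0 (PF n) t01).
rewrite /Fn addrAC subrr add0r normrM gtr0_norm//.
by case/andP: (th01 n).
Qed.

(** [Kstat] has sub-exponential tails under the null hypothesis, so that its
    critical value is logarithmic in the sample size and in the level. *)
Lemma power_K_ge n j alpha r s : (0 < j)%N -> 0 < alpha < 1 -> 0 <= r ->
  j%:R * (4 * expR (- (r / 4))) <= alpha ->
  2 * (r + 1) + s < Num.sqrt j%:R * (theta n * a) ->
  ((1 - 4 * expR (- (s / 4)))%:E <= power (P n) (@Kstat R) alpha j)%E.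
Proof.
move=> j0 al r0 hr hs; rewrite power_KE// lee_fin.
have crit : critical_value (@Kstat R) alpha j <= 2 * (r + 1).
  rewrite critical_value_K//; apply: quantile_le => //; first exact: Kstat_ge0.
  by apply: le_trans hr; exact: Kstat_null_tail.
by apply: Kstat_alt_model => //; lra.
Qed.

(** With [y = sqrt (j / n)] the signal is at least [y * ln n ^ 3 * a], while
    [ln j <= ln n + 2 * y]; as [y >= sqrt e], the signal wins for all [j] as
    soon as [ln n] is large in terms of [e], [a] and [s]. *)
Lemma near_signal_dominates (e s : R) : 0 < e -> e <= 1 ->
  \forall n \near \oo, forall j : nat, e * n%:R <= j%:R ->
  2 * (4 * ln (32 * j%:R * n%:R ^+ 7) + 1) + s < Num.sqrt j%:R * (theta n * a).
Proof.
move=> e0 e1.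
pose c1 := 8 * ln 32 + 2 + `|s|.
near=> n => j ej.
have n0 : 0 < n%:R :> R.
  by apply: (@lt_le_trans _ _ 1) => //; near: n; exact: nbhs_infty_ger.
have j0 : 0 < j%:R :> R by apply: lt_le_trans ej; rewrite mulr_gt0.
set L : R := ln n%:R.
have sn : 0 < Num.sqrt n%:R :> R by rewrite sqrtr_gt0.
have se : 0 < Num.sqrt e by rewrite sqrtr_gt0.
have L1 : 1 <= L by rewrite /L; near: n; exact: near_ln_ge.
have L2 : 32 / a <= L by rewrite /L; near: n; exact: near_ln_ge.
have L3 : 2 * (65 + c1) / (a * Num.sqrt e) <= L by rewrite /L; near: n; exact: near_ln_ge.
have hs : L ^+ 3 <= Num.sqrt n%:R * theta n by rewrite /L; near: n; exact: signal.
pose y : R := Num.sqrt (j%:R / n%:R).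
have jn : j%:R / n%:R > 0 :> R by rewrite divr_gt0.
have y0 : 0 < y by rewrite sqrtr_gt0.
have yy : y ^+ 2 = j%:R / n%:R by rewrite sqr_sqrtr// ltW.
have jE : j%:R = n%:R * y ^+ 2 :> R by rewrite yy mulrC divfK// gt_eqF.
have ye : Num.sqrt e <= y by rewrite ler_wsqrtr// ler_pdivlMr.
have sj : Num.sqrt j%:R = Num.sqrt n%:R * y :> R.
  by rewrite jE sqrtrM ?ler0n// sqrtr_sqr gtr0_norm.
have lj : ln (32 * j%:R * n%:R ^+ 7) <= ln 32 + 8 * L + 2 * y.
  rewrite lnM ?posrE ?mulr_gt0 ?exprn_gt0// lnM ?posrE ?mulr_gt0// jE.
  rewrite lnM ?posrE ?exprn_gt0// !lnXn// -/L.
  have := ltW (ln_sublinear y0); rewrite -[L *+ 7]mulr_natl -[ln y *+ 2]mulr_natl.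
  by lra.
have c10 : 0 <= c1.
  by rewrite /c1 !addr_ge0// mulr_ge0// ln_ge0//; lra.
apply: (@le_lt_trans _ _ (c1 + 64 * L + 16 * y)).
  by have := ler_norm s; rewrite /c1; lra.
apply: (@lt_le_trans _ _ (y * L ^+ 3 * a)); last first.
  rewrite sj [leRHS](_ : _ = y * (Num.sqrt n%:R * theta n) * a); last by ring.
  by rewrite ler_pM2r// ler_pM2l.
have h2 : 32 <= a * L by rewrite mulrC -ler_pdivrMr.
have h3 : 2 * (65 + c1) <= Num.sqrt e * a * L.
  by move: L3; rewrite ler_pdivrMr ?mulr_gt0//; lra.
have LL : L <= L ^+ 2 by rewrite expr2 ler_peMl//; lra.
have k1 : 16 * y <= y * L ^+ 3 * a / 2.
  have : 32 <= L ^+ 2 * (a * L).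
    by apply: (le_trans h2); rewrite ler_peMl// ?mulr_ge0//; lra.
  by rewrite exprSr => h; have := ler_wpM2l (ltW y0) h; lra.
have k2 : c1 + 65 * L <= y * L ^+ 3 * a / 2.
  have : c1 + 65 * L <= (65 + c1) * L ^+ 2 by nra.
  move=> h; apply: (le_trans h).
  have := ler_wpM2r (sqr_ge0 L) h3.
  have := ler_wpM2r (mulr_ge0 (ltW a0) (exprn_ge0 3 (le_trans ler01 L1))) ye.
  by rewrite exprSr; lra.
by lra.
Unshelve. all: by end_near. Qed.

Context (level_ge : forall alpha, admissible (@Mstat R) P alpha ->
  \forall n \near \oo, (8 * n%:R ^+ 7)^-1 <= alpha n).

(** Let [b < 1] bound the power of [Mstat]. The number [s] is such that [Kstat]
    exceeds its signal minus [s] with probability at least [b], and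
    [r = 4 * ln (32 * j * n ^ 7)] such that its tail at [2 * (r + 1)] under the
    uniform law is at most [1 / (8 n ^ 7)], hence at most the level. *)
Lemma near_required_size alpha (e : R) : 0 < e -> e <= 1 ->
  admissible (@Mstat R) P alpha ->
  \forall n \near \oo,
    (required_size (@Mstat R) (@Kstat R) P alpha n <= (2 * e * n%:R)%:E)%E.
Proof.
move=> e0 e1 adm; have := adm => -[al01 _ _ [_ _ /[dup] sup1 _]].
have [b b1 hb] : exists2 b : R, b < 1 &
    \forall n \near \oo, (power (P n) (@Mstat R) (alpha n) n < b%:E)%E.
  have hlim (b : R) : b < 1 ->
      (limn_esup (fun n => power (P n) (@Mstat R) (alpha n) n) < b%:E)%E ->
      exists2 b : R, b < 1 &
      \forall n \near \oo, (power (P n) (@Mstat R) (alpha n) n < b%:E)%E.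
    by move=> b1 /limn_esup_lt h; exists b.
  case E : (limn_esup _) sup1 => [r| |] //.
    rewrite lte_fin => r1; apply: (hlim ((r + 1) / 2)); first by lra.
    by rewrite E lte_fin; lra.
  by move=> _; apply: (hlim 0) => //; rewrite E ltNy0.
pose s := 4 * ln (4 / (1 - b)).
near=> n.
have n0 : 0 < n%:R :> R.
  by apply: (@lt_le_trans _ _ 1) => //; near: n; exact: nbhs_infty_ger.
pose m := (Num.truncn (e * n%:R)).+1.
have en0 : 0 <= e * n%:R by rewrite mulr_ge0// ltW.
have em : e * n%:R <= m%:R by exact/ltW/truncnS_gt.
have me : m%:R <= 2 * e * n%:R.
  have : m%:R <= e * n%:R + 1 by rewrite /m -natr1 lerD2r truncn_le.
  have : 1 <= e * n%:R.
    by rewrite mulrC -ler_pdivrMr//; near: n; exact: nbhs_infty_ger.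
  by lra.
apply: (@le_trans _ _ (m%:R)%:E); last by rewrite lee_fin.
apply: ereal_inf_lbound; exists m => //=; split => // k.
have hpow : (power (P n) (@Mstat R) (alpha n) n < b%:E)%E by near: n.
apply: (le_trans (ltW hpow)).
have mk : e * n%:R <= (m + k)%:R by rewrite natrD; apply: (le_trans em); rewrite lerDl.
have mk0 : 0 < (m + k)%:R :> R by rewrite ltr0n.
have lev : (8 * n%:R ^+ 7)^-1 <= alpha n by near: n; exact: level_ge.
have n7 : 1 <= n%:R ^+ 7 :> R.
  by apply: exprn_ege1; near: n; exact: nbhs_infty_ger.
have big : 1 <= 32 * (m + k)%:R * n%:R ^+ 7 :> R.
  have h1 : 1 <= (m + k)%:R :> R by rewrite ler1n.
  by nra.
have bigp : 0 < 32 * (m + k)%:R * n%:R ^+ 7 :> R by lra.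
have sE : 1 - 4 * expR (- (s / 4)) = b.
  have b' : 0 < 1 - b by lra.
  by rewrite /s expR_ln4 ?divr_gt0//; field; rewrite gt_eqF.
rewrite -sE; apply: (@power_K_ge _ _ _ (4 * ln (32 * (m + k)%:R * n%:R ^+ 7))) => //.
- by rewrite mulr_ge0// ln_ge0.
- rewrite expR_ln4// (_ : _ * _ = (8 * n%:R ^+ 7)^-1)//.
  by field; rewrite !gt_eqF//; lra.
- move: (m + k)%N mk {mk0 big bigp}; near: n; exact: near_signal_dominates.
Unshelve. all: by end_near. Qed.

Lemma required_size_ratio alpha : admissible (@Mstat R) P alpha ->
  (required_size (@Mstat R) (@Kstat R) P alpha n * (n%:R^-1)%:E)%E
    @[n --> \oo] --> 0%E.
Proof.
move=> adm.
pose u n := (required_size (@Mstat R) (@Kstat R) P alpha n * (n%:R^-1)%:E)%E.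
have u0 n : (0 <= u n)%E.
  apply: mule_ge0; last by rewrite lee_fin invr_ge0.
  by apply: le_ereal_inf_tmp => _ [m _ <-]; rewrite lee_fin.
have ue (e : R) : 0 < e -> e <= 1 -> \forall n \near \oo, (u n <= (2 * e)%:E)%E.
  move=> e0 e1; near=> n.
  have n0 : 0 < n%:R :> R.
    by apply: (@lt_le_trans _ _ 1) => //; near: n; exact: nbhs_infty_ger.
  rewrite (_ : (2 * e)%:E = ((2 * e * n%:R)%:E * (n%:R^-1)%:E)%E); last first.
    by rewrite -EFinM mulfK// gt_eqF.
  apply: lee_wpmul2r; first by rewrite lee_fin invr_ge0 ltW.
  by near: n; exact: near_required_size.
apply/fine_cvgP; split.
  near=> n; rewrite -/(u n) ge0_fin_numE//.
  have : (u n <= (2 * 1)%:E)%E by near: n; exact: ue.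
  by move=> /le_lt_trans; apply; rewrite ltry.
apply/cvgrPdist_le => e e0.
pose m := Num.min (e / 2) 1.
have m0 : 0 < m by rewrite lt_min divr_gt0//=.
have m1 : m <= 1 by rewrite ge_min lexx orbT.
have me : m <= e / 2 by rewrite ge_min lexx.
near=> n => /=; rewrite -/(u n) sub0r normrN.
have : (u n <= (2 * m)%:E)%E by near: n; exact: (ue _ m0 m1).
have := u0 n; case: (u n) => [r| |] //; rewrite !lee_fin => r0 rm.
by rewrite ger0_norm//; apply: (le_trans rm); lra.
Unshelve. all: by end_near. Qed.

End efficiency.


(** * Existence of admissible levels *)

Section existence.
Context {R : realType} (A : R -> R) (theta : nat -> R)
  (P : nat -> probability (measurableTypeR R) R) (t0 : R) (t01 : 0 < t0 < 1)
  (a0 : 0 < `|A t0|)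
  (C : R) (C0 : 0 <= C) (AC : forall t, 0 < t < 1 -> `|A t| <= C * wt t)
  (th01 : forall n, 0 < theta n < 1)
  (PF : forall n, law01 (P n) (Fn A theta n))
  (signal : \forall n \near \oo, ln n%:R ^+ 3 <= Num.sqrt n%:R * theta n).

Local Notation a := (`|A t0|).

Definition median_M n : R := quantile (product_power (P n) n) (@Mstat R n) 2^-1.

(** Testing at this level has power [1 / 2] under [P n]. *)
Definition median_level n : R :=
  pr (product_power (@unif01 R) n) [set x | median_M n < Mstat x].

Let half01 : 0 < (2^-1 : R) < 1. Proof. by apply/andP; split; lra. Qed.

Let M0 n (x : n.-tuple R) : 0 <= Mstat x. Proof. exact: sqrtr_ge0. Qed.

(** The median is at most [sqrtln1 (n ^ 3)], by [model_Sstat_tail]. *)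
Lemma near_median_level_ge :
  \forall n \near \oo, (8 * n%:R ^+ 7)^-1 <= median_level n.
Proof.
near=> n.
have n3 : (3 < n)%N by near: n; exact: nbhs_infty_gt.
have n0 : (0 < n)%N by exact: leq_trans n3.
have np : 0 < n%:R :> R by rewrite ltr0n.
have n30 : 0 <= n%:R ^+ 3 :> R by rewrite exprn_ge0.
have nC : (2 + 2 * C) * 2 <= n%:R by near: n; exact: nbhs_infty_ger.
have qn : median_M n <= sqrtln1 (n%:R ^+ 3).
  apply: quantile_le => //; rewrite Mstat_gtE//.
  apply: (le_trans (model_Sstat_tail C0 AC th01 PF n3)).
  by rewrite ler_pdivrMr//; lra.
apply: (le_trans (null_Sstat_lower (ltnW (ltnW n3)))).
rewrite -Mstat_gtE//; apply: le_pr; [exact: measurable_Mstat_gt..|].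
by move=> x /=; exact: le_lt_trans.
Unshelve. all: by end_near. Qed.

(** [Kstat], and with it [Sstat], is at least
    [sqrt n * theta n * a - s >= a * ln n ^ 3 - s] with probability at
    least [3 / 4]. *)
Lemma near_median_M_ge : \forall n \near \oo,
  sqrtln1 (3 * (8 * ln n%:R + 1) ^+ 2) <= median_M n.
Proof.
(* [1 - 4 * expR (- (s / 4)) = 3 / 4] *)
pose s : R := 4 * ln 16.
near=> n.
have n0 : (0 < n)%N by near: n; exact: nbhs_infty_gt.
set L : R := ln n%:R.
have L1 : 1 <= L by rewrite /L; near: n; exact: near_ln_ge.
have L2 : (244 + s) / a <= L by rewrite /L; near: n; exact: near_ln_ge.
have hs : L ^+ 3 <= Num.sqrt n%:R * theta n by rewrite /L; near: n; exact: signal.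
have y0 : 0 <= 3 * (8 * L + 1) ^+ 2 by rewrite mulr_ge0// sqr_ge0.
have s0 : 0 <= s by rewrite mulr_ge0// ln_ge0//; lra.
apply: (quantile_gt (measurable_Mstat_gt n0) half01).
rewrite Mstat_gtE//; apply: lt_le_trans (pr_Kstat_le_Sstat n0 (PF n) y0).
have L3 : 244 + s <= L * a by rewrite -ler_pdivrMr.
apply: (@lt_le_trans _ _ (1 - 4 * expR (- (s / 4)))).
  by rewrite /s expR_ln4//; lra.
apply: (Kstat_alt_model t01 th01 PF n0).
have h1 : (244 + s) * L ^+ 2 <= L ^+ 3 * a.
  by rewrite exprS mulrAC ler_wpM2r// sqr_ge0.
have h2 : L ^+ 3 * a <= Num.sqrt n%:R * (theta n * a).
  by rewrite mulrA ler_wpM2r// ltW.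
have : 1 <= L ^+ 2 by rewrite exprn_ege1.
have : s <= s * L ^+ 2 by rewrite ler_peMr// exprn_ege1.
have : L <= L ^+ 2 by rewrite expr2 ler_peMl//; lra.
lra.
Unshelve. all: by end_near. Qed.

(** The choice [r = 8 * ln n] in [Sstat_null_tail] turns [expR (- (r / 4))] into
    [1 / n ^ 2], which absorbs the [n] grid points. *)
Lemma near_median_level_le : \forall n \near \oo,
  median_level n <= (8 * ln n%:R)^-1 + 4 / n%:R.
Proof.
near=> n.
have n1 : (1 < n)%N by near: n; exact: nbhs_infty_gt.
have n0 : (0 < n)%N by exact: ltnW.
have np : 0 < n%:R :> R by rewrite ltr0n.
have L1 : 1 <= ln (n%:R : R) by near: n; exact: near_ln_ge.
have q : sqrtln1 (3 * (8 * ln n%:R + 1) ^+ 2) <= median_M n.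
  by near: n; exact: near_median_M_ge.
have y0 : 0 <= 3 * (8 * ln (n%:R : R) + 1) ^+ 2 by rewrite mulr_ge0// sqr_ge0.
apply: (@le_trans _ _ (pr (product_power (@unif01 R) n)
    [set x | 3 * (8 * ln n%:R + 1) ^+ 2 < Sstat x])).
  rewrite -Mstat_gtE//; apply: le_pr; [exact: measurable_Mstat_gt..|].
  by move=> x /=; exact: le_lt_trans.
have r1 : 1 <= 8 * ln (n%:R : R) by lra.
apply: (le_trans (Sstat_null_tail n0 n1 r1)); rewrite lerD2l.
have -> : - (8 * ln (n%:R : R) / 4) = - (4 * ln (n%:R ^+ 2) / 4).
  by rewrite lnXn// mulr2n; field.
rewrite expR_ln4 ?exprn_gt0// le_eqVlt; apply/orP; left; apply/eqP.
by field; rewrite gt_eqF.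
Unshelve. all: by end_near. Qed.

Lemma near_median_level_small (e : R) : 0 < e ->
  \forall n \near \oo, median_level n <= e.
Proof.
move=> e0; near=> n.
have n0 : 0 < n%:R :> R.
  by apply: (@lt_le_trans _ _ 1) => //; near: n; exact: nbhs_infty_ger.
have L1 : 1 <= ln (n%:R : R) by near: n; exact: near_ln_ge.
have L2 : e^-1 <= ln (n%:R : R) by near: n; exact: near_ln_ge.
have n2 : 8 / e <= n%:R by near: n; exact: nbhs_infty_ger.
have h : median_level n <= (8 * ln n%:R)^-1 + 4 / n%:R.
  by near: n; exact: near_median_level_le.
apply: (le_trans h).
have h1 : (8 * ln (n%:R : R))^-1 <= e / 2.
  rewrite invf_ple ?posrE ?divr_gt0 ?mulr_gt0//; last by lra.
  by rewrite invfM invrK; lra.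
have h2 : 4 / n%:R <= e / 2 by move: n2; rewrite !ler_pdivrMr//; lra.
by lra.
Unshelve. all: by end_near. Qed.

Lemma near_median_level01 : \forall n \near \oo, 0 < median_level n < 1.
Proof.
near=> n; apply/andP; split.
  apply: (@lt_le_trans _ _ (8 * n%:R ^+ 7)^-1).
    rewrite invr_gt0 mulr_gt0// exprn_gt0// ltr0n.
    by near: n; exact: nbhs_infty_gt.
  by near: n; exact: near_median_level_ge.
apply: (@le_lt_trans _ _ 2^-1); last by lra.
by near: n; apply: near_median_level_small; rewrite invr_gt0.
Unshelve. all: by end_near. Qed.

Lemma near_median_power : \forall n \near \oo,
  power (P n) (@Mstat R) (median_level n) n = 2^-1%:E.
Proof.
near=> n.
have n0 : (0 < n)%N by near: n; exact: nbhs_infty_gt.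
have L1 : 1 <= ln (n%:R : R) by near: n; exact: near_ln_ge.
have q0 : 0 < median_M n.
  apply: (@lt_le_trans _ _ (sqrtln1 (3 * (8 * ln n%:R + 1) ^+ 2))); last first.
    by near: n; exact: near_median_M_ge.
  have p : 0 < 3 * (8 * ln (n%:R : R) + 1) ^+ 2 by rewrite mulr_gt0// exprn_gt0//; lra.
  by rewrite (le_lt_trans (sqrtr_ge0 (ln (0 + 1))))// sqrtln1_lt// ltW.
have a01 : 0 < median_level n < 1 by near: n; exact: near_median_level01.
have [-> leE] := power_at_level n0 (PF n) q0 erefl a01.
congr (_%:E); apply/eqP; rewrite eq_le; apply/andP; split.
  exact: (pr_quantile_le _ (measurable_Mstat_gt n0) half01).
rewrite -leE.
exact: (pr_quantile_ge _ (measurable_Mstat_gt n0) (@M0 n) half01).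
Unshelve. all: by end_near. Qed.

(** Only large [n] matter; the value [1 / 2] is a default that keeps every term
    of the sequence in the open unit interval. *)
Lemma admissible_exists : exists alpha, admissible (@Mstat R) P alpha.
Proof.
pose alpha n : R := if 0 < median_level n < 1 then median_level n else 2^-1.
have alE : \forall n \near \oo, alpha n = median_level n.
  by apply: filterS near_median_level01 => n h; rewrite /alpha h.
have powcvg : power (P n) (@Mstat R) (alpha n) n @[n --> \oo] --> 2^-1%:E.
  apply: cvg_near_cst; near=> n.
  have -> : alpha n = median_level n by near: n.
  by near: n; exact: near_median_power.
have [infE supE] := cvg_limn_einf_sup powcvg.
exists alpha; split.
- by move=> n; rewrite /alpha; case: ifP.
- apply/cvgrPdist_le => e e0; near=> n; rewrite sub0r normrN.
  have -> : alpha n = median_level n by near: n.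
  rewrite ger0_norm ?pr_ge0//.
  by near: n; exact: near_median_level_small.
- apply/cvgrPdist_le => e e0; near=> n; rewrite sub0r normrN.
  have -> : alpha n = median_level n by near: n.
  have n0 : (0 < n)%N by near: n; exact: nbhs_infty_gt.
  have np : 0 < n%:R :> R by rewrite ltr0n.
  have /andP[m0 m1] : 0 < median_level n < 1 by near: n; exact: near_median_level01.
  have lev : (8 * n%:R ^+ 7)^-1 <= median_level n.
    by near: n; exact: near_median_level_ge.
  have sn : 0 < Num.sqrt n%:R :> R by rewrite sqrtr_gt0.
  have s1 : 1 <= Num.sqrt n%:R :> R by rewrite -[leLHS]sqrtr1 ler_wsqrtr// ler1n.
  have ne : (22 / e) ^+ 2 <= n%:R by near: n; exact: nbhs_infty_ger.
  have se : 22 / e <= Num.sqrt n%:R.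
    have e22 : 0 <= 22 / e by rewrite divr_ge0// ltW.
    by rewrite -ler_sqr ?nnegrE ?sqrtr_ge0// sqr_sqrtr// ltW.
  have ln1 : ln (median_level n) <= 0 by apply: ln_le0; exact: ltW.
  have ln2 : - ln (median_level n) <= 22 * Num.sqrt n%:R.
    have : ln (8 * n%:R ^+ 7)^-1 <= ln (median_level n).
      by rewrite ler_ln ?posrE ?invr_gt0 ?mulr_gt0 ?exprn_gt0.
    rewrite lnV ?posrE ?mulr_gt0 ?exprn_gt0// lnM ?posrE ?exprn_gt0// lnXn//.
    rewrite -[_ *+ 7]mulr_natl.
    have := @ln_le_sqrt R n n0; have := ltW (@ln_sublinear R 8 (ltr0n _ 8)).
    by lra.
  rewrite normrM (ler0_norm ln1) gtr0_norm ?invr_gt0// mulrC ler_pdivrMr//.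
  apply: (le_trans ln2); move: se; rewrite ler_pdivrMr// => se.
  rewrite -[X in e * X](sqr_sqrtr (ler0n R n)) expr2 mulrA ler_pM2r//.
  by rewrite [e * _]mulrC.
- by rewrite infE supE !lte_fin; split => //; lra.
Unshelve. all: by end_near. Qed.

End existence.

(** * Ratio of the slopes *)

(** By [ln x < x] the numerator is at most linear in [z = sqrt n * theta n],
    while the denominator is quadratic in [z], which tends to infinity. *)
Lemma slope_ratio_cvg (R : realType) (A : R -> R) (theta : nat -> R) (t0 C : R) :
  0 < t0 < 1 -> 0 < `|A t0| -> (forall t, 0 < t < 1 -> `|A t| <= C * wt t) ->
  0 <= C -> (forall n, 0 < theta n < 1) ->
  (\forall n \near \oo, ln n%:R ^+ 3 <= Num.sqrt n%:R * theta n) ->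
  (cM * bM A (theta n) n ^+ 2) / (cK * bK A (theta n) n ^+ 2) @[n --> \oo]
    --> (0 : R).
Proof.
move=> t01 a0 AC C0 th01 signal.
set a := `|A t0| in a0.
pose SA := sup [set `|A t| / Num.sqrt (t * (1 - t)) | t in `]0, 1[].
pose KA := sup [set `|A t| | t in `]0, 1[].
have aK : a <= KA.
  apply: ub_le_sup; last by exists t0 => //=; rewrite in_itv.
  exists C => _ [t /= + <-]; rewrite in_itv/= => h; apply: (le_trans (AC t h)).
  rewrite ler_piMr//; apply: (@le_trans _ _ 2^-1); last by lra.
  by apply: wt_le; case/andP: h => *; apply/andP; split; exact: ltW.
have SA0 : 0 <= SA.
  apply: (@le_trans _ _ (`|A t0| / Num.sqrt (t0 * (1 - t0)))).
    by rewrite divr_ge0 ?sqrtr_ge0.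
  apply: ub_le_sup; last by exists t0 => //=; rewrite in_itv.
  exists C => _ [t /= + <-]; rewrite in_itv/= => h.
  by rewrite -/(wt t) ler_pdivrMr ?wt_gt0// AC.
have K0 : 0 < KA := lt_le_trans a0 aK.
apply/cvgrPdist_le => e e0; near=> n; rewrite sub0r normrN.
set L : R := ln n%:R.
have L1 : 1 <= L by rewrite /L; near: n; exact: near_ln_ge.
have L2 : SA / KA ^+ 2 / e <= L by rewrite /L; near: n; exact: near_ln_ge.
have hs : L ^+ 3 <= Num.sqrt n%:R * theta n by rewrite /L; near: n; exact: signal.
rewrite /cM /cK /bM /bK -/SA -/KA.
set z := Num.sqrt n%:R * theta n in hs *.
have Lz : L <= z.
  by apply: le_trans hs; rewrite exprS ler_peMr ?exprn_ege1//; lra.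
have z0 : 0 < z by lra.
have b0 : Num.sqrt (ln (z * SA)) ^+ 2 <= z * SA.
  have [l0|l0] := leP 0 (ln (z * SA)); last first.
    by rewrite (ler0_sqrtr (ltW l0)) expr0n; exact: mulr_ge0 (ltW z0) SA0.
  rewrite sqr_sqrtr//; have [zS|zS] := leP (z * SA) 0.
    by rewrite ln0//; exact: mulr_ge0 (ltW z0) SA0.
  exact/ltW/ln_sublinear.
have zK : 0 < z * KA by rewrite mulr_gt0.
rewrite ger0_norm; last by rewrite divr_ge0// mulr_ge0// sqr_ge0.
have den : 0 < 2 * (z * KA) ^+ 2 by rewrite pmulr_rgt0// exprn_gt0.
rewrite ler_pdivrMr//.
move: L2; rewrite !ler_pdivrMr ?exprn_gt0// => L2.
have : SA * z <= z * e * KA ^+ 2 * z.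
  rewrite ler_wpM2r ?(ltW z0)//; apply: (le_trans L2).
  by rewrite ler_wpM2r ?sqr_ge0// ler_wpM2r// ltW.
by rewrite exprMn; lra.
Unshelve. all: by end_near. Qed.

Unset Implicit Arguments.

Theorem theorem5 (R : realType) (A : R -> R) (varpi : R) (theta : nat -> R)
    (P : nat -> probability (measurableTypeR R) R) :
  {within `[0, 1], continuous A} ->
  A 0 = 0 -> A 1 = 0 ->
  (exists2 t, t \in `[0, 1] & A t != 0) ->
  0 <= varpi < 1 / 2 ->
  (ereal_sup [set (`|A t| / (t * (1 - t)) `^ (1 - varpi))%:E | t in `]0%R, 1%R[]
     < +oo)%E ->
  (forall n, 0 < theta n < 1) ->
  theta @ \oo --> (0 : R) ->
  (forall n (t : R), 0 < t < 1 -> P n `]-oo, t]%classic = (t + theta n * A t)%:E) ->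
  theta =o_\oo (fun n => n%:R `^ (- varpi)) ->
  ln (n%:R * theta n ^+ 2) / ln (ln n%:R) @[n --> \oo] --> +oo ->
  intermediate_efficiency Mstat Kstat P 0%E /\
  (cM * bM A (theta n) n ^+ 2) / (cK * bK A (theta n) n ^+ 2) @[n --> \oo]
    --> (0 : R).
Proof.
move=> cA A0 A1 [t0 t0in At0] v2 hsup th01 _ hP _ hrate.
have a0 : 0 < `|A t0| by rewrite normr_gt0.
have t01 : 0 < t0 < 1.
  move: t0in; rewrite in_itv/= => /andP[t00 t11]; apply/andP; split.
    rewrite lt_neqAle t00 andbT; apply: contra_neq At0 => <-; exact: A0.
  rewrite lt_neqAle t11 andbT; apply: contra_neq At0 => ->; exact: A1.
have [C C0 AC] := envelope_wt v2 hsup.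
have PF n : law01 (P n) (Fn A theta n) by exact: (law01_model cA A0 A1 (hP n)).
have signal := near_signal th01 hrate.
split; last exact: (slope_ratio_cvg t01 a0 AC C0 th01 signal).
split; first exact: (admissible_exists t01 a0 C0 AC th01 PF signal).
move=> alpha; apply: (required_size_ratio t01 a0 th01 PF signal).
exact: (admissible_level_ge C0 AC th01 PF).
Qed.
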